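(* The following groups have the $R_\infty$-property: (i) the group $S_\infty$ of finitary permutations of $\mathbb{N}$; (ii) the Houghton groups $H_n$ for all $n\ge 2$; (iii) the group $G_n$ of pure symmetric automorphisms of a free group of rank $n$, for all $n\ge 2$.
   Context: $\mathbb{N}=\{1,2,3,\dots\}$. For a group $\Gamma$ and an automorphism $\phi$ of $\Gamma$, two elements $x,y\in\Gamma$ are $\phi$-twisted conjugate if $y=\gamma x\phi(\gamma^{-1})$ for some $\gamma\in\Gamma$; this is an equivalence relation and $R(\phi)$ denotes the number of its equivalence classes ($R(\phi)=\infty$ if there are infinitely many). The group $\Gamma$ has the $R_\infty$-property if $R(\phi)=\infty$ for every $\phi\in\mathrm{Aut}(\Gamma)$. A permutation of a set is finitary if it fixes all but finitely many elements; $S_\infty$ is the group of all finitary permutations of $\mathbb{N}$. For $n\ge 2$ let $M_n=\{1,\dots,n\}\times\mathbb{N}$. The Houghton group $H_n$ is the group (under composition) of all bijections $f:M_n\to M_n$ for which there exist integers $t_1,\dots,t_n$ such that, for every $j\le n$, $f(j,s)=(j,s+t_j)$ for all sufficiently large $s\in\mathbb{N}$. For $n\ge 2$ let $F_n$ be the free group with basis $x_1,\dots,x_n$. For $1\le i\ne j\le n$ let $\alpha_{ij}\in\mathrm{Aut}(F_n)$ be the automorphism with $x_i\mapsto x_jx_ix_j^{-1}$ and $x_k\mapsto x_k$ for $k\ne i$. The group $G_n$ of pure symmetric automorphisms of $F_n$ is the subgroup of $\mathrm{Aut}(F_n)$ generated by all $\alpha_{ij}$, $1\le i\neq j\le n$.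 *)

(* Defs.v *)
From HB Require Import structures.
From mathcomp Require Import all_boot ssralg ssrint zify.
From mathcomp Require Import boolp classical_sets cardinality.

Set Implicit Arguments.
Unset Strict Implicit.
Unset Printing Implicit Defensive.

Local Open Scope group_scope.

(* Bijections T -> T under composition: (f * g) x = f (g x).  The library's
   {perm T} only covers finite T (and composes in the opposite order). *)

Record symgrp (T : choiceType) :=
  SymGrp { symfun :> T -> T; _ : `[< bijective symfun >] }.

HB.instance Definition _ (T : choiceType) := [isSub for @symfun T].
HB.instance Definition _ (T : choiceType) := [Choice of symgrp T by <:].

Section SymGroup.
Variable T : choiceType.
Implicit Types f g : symgrp T.

Lemma sym_bij f : bijective f.
Proof. by case: f => f fP; apply/asboolP. Qed.

Lemma symP f g : f =1 g -> f = g.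
Proof. by move=> fg; apply/val_inj/funext. Qed.

Definition symgrp_of (h : T -> T) (hP : bijective h) : symgrp T :=
  SymGrp (asboolT hP).

Lemma id_bij : bijective (@id T). Proof. by exists id. Qed.

Definition sym1 : symgrp T := symgrp_of id_bij.

Definition symM f g : symgrp T :=
  symgrp_of (bij_comp (sym_bij f) (sym_bij g)).

Lemma sym_inv_ex f : {g : symgrp T | cancel f g /\ cancel g f}.
Proof.
apply: cid; have [g fK gK] := sym_bij f.
by exists (symgrp_of (Bijective gK fK)).
Qed.

Definition symV f : symgrp T := sval (sym_inv_ex f).

Lemma symVK f : cancel (symV f) f.
Proof. by rewrite /symV; case: (sym_inv_ex f) => g []. Qed.

Lemma symKV f : cancel f (symV f).
Proof. by rewrite /symV; case: (sym_inv_ex f) => g []. Qed.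

Lemma symMA : associative symM. Proof. by move=> f g h; apply: symP. Qed.
Lemma sym1M : left_id sym1 symM. Proof. by move=> f; apply: symP. Qed.
Lemma symM1 : right_id sym1 symM. Proof. by move=> f; apply: symP. Qed.
Lemma symVM : left_inverse sym1 symV symM.
Proof. by move=> f; apply: symP => x; exact: symKV. Qed.
Lemma symMV : right_inverse sym1 symV symM.
Proof. by move=> f; apply: symP => x; exact: symVK. Qed.

HB.instance Definition _ :=
  isGroup.Build (symgrp T) symMA sym1M symM1 symVM symMV.

Lemma symgrp1E x : (1 : symgrp T) x = x. Proof. by []. Qed.
Lemma symgrpME f g x : (f * g) x = f (g x). Proof. by []. Qed.
Lemma symgrpK f : cancel f f^-1. Proof. exact: symKV. Qed.
Lemma symgrpVK f : cancel f^-1 f. Proof. exact: symVK. Qed.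

End SymGroup.

Section GroupMorphisms.
Variables (G H : groupType) (f : G -> H) (fM : {morph f : x y / x * y}).

Lemma morph_group1 : f 1 = 1.
Proof. by apply: (@mulgI _ (f 1)); rewrite -fM !mulg1. Qed.

Lemma morph_groupV : {morph f : x / x^-1}.
Proof.
by move=> x; apply: (@mulgI _ (f x)); rewrite -fM !mulgV morph_group1.
Qed.

End GroupMorphisms.

Definition is_morph (G : groupType) (f : symgrp G) : bool :=
  `[< {morph f : x y / x * y} >].

Record autgrp (G : groupType) :=
  AutGrp { autfun :> symgrp G; _ : is_morph autfun }.

HB.instance Definition _ (G : groupType) := [isSub for @autfun G].
HB.instance Definition _ (G : groupType) := [Choice of autgrp G by <:].

Lemma is_morph_closed (G : groupType) : group_closed (@is_morph G).
Proof.
split=> [|f g /asboolP fM /asboolP gM]; first exact/asboolP.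
apply/asboolP => x y; rewrite !symgrpME -fM; congr (f _).
by apply: (can_inj (symgrpK g)); rewrite gM !symgrpVK.
Qed.

HB.instance Definition _ (G : groupType) :=
  SubChoice_isSubGroup.Build (symgrp G) (@is_morph G) (autgrp G)
    (@is_morph_closed G).

Lemma autgrpM (G : groupType) (phi : autgrp G) : {morph phi : x y / x * y}.
Proof. by case: phi => f /= /asboolP. Qed.

Section TwistedConjugacy.
Variable G : groupType.

Definition twisted_conj (phi : autgrp G) (x y : G) : Prop :=
  exists g : G, y = g * x * phi g^-1.

Lemma twisted_conj_refl phi x : twisted_conj phi x x.
Proof. by exists 1; rewrite invg1 (morph_group1 (autgrpM phi)) mul1g mulg1. Qed.

Lemma twisted_conj_sym phi x y : twisted_conj phi x y -> twisted_conj phi y x.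
Proof.
case=> g ->; exists g^-1.
by rewrite -!mulgA -autgrpM mulgV (morph_group1 (autgrpM phi)) mulg1 mulKg.
Qed.

Lemma twisted_conj_trans phi x y z :
  twisted_conj phi x y -> twisted_conj phi y z -> twisted_conj phi x z.
Proof.
by case=> g -> [h ->]; exists (h * g); rewrite invgM autgrpM !mulgA.
Qed.

Definition twisted_class (phi : autgrp G) (x : G) : set G :=
  [set y | twisted_conj phi x y].

Definition twisted_classes (phi : autgrp G) : set (set G) :=
  range (twisted_class phi).

Definition R_infinity_property : Prop :=
  forall phi : autgrp G, infinite_set (twisted_classes phi).

End TwistedConjugacy.

Arguments R_infinity_property G : clear implicits.

Section Generated.
Variables (G : groupType) (A : set G).

Definition generated (x : G) : bool :=
  `[< forall S : {pred G}, group_closed S ->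
        (forall a, A a -> a \in S) -> x \in S >].

Lemma generated_closed : group_closed generated.
Proof.
split=> [|x y /asboolP xA /asboolP yA]; apply/asboolP => S SG AS.
  by case: SG.
by case: (SG) => _; apply; [exact: xA|exact: yA].
Qed.

Record gengrp := GenGrp { genval :> G; _ : generated genval }.

HB.instance Definition _ := [isSub for genval].
HB.instance Definition _ := [Choice of gengrp by <:].
HB.instance Definition _ :=
  SubChoice_isSubGroup.Build G generated gengrp generated_closed.

End Generated.

Definition finitary (T : choiceType) (f : symgrp T) : bool :=
  `[< finite_set [set x | f x <> x] >].

Record fsymgrp (T : choiceType) :=
  FSymGrp { fsymval :> symgrp T; _ : finitary fsymval }.

HB.instance Definition _ (T : choiceType) := [isSub for @fsymval T].
HB.instance Definition _ (T : choiceType) := [Choice of fsymgrp T by <:].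

Lemma finitary_closed (T : choiceType) : group_closed (@finitary T).
Proof.
split=> [|f g /asboolP fF /asboolP gF]; apply/asboolP.
  by rewrite (_ : mkset _ = set0)//; apply/seteqP; split=> x.
apply: (@sub_finite_set _ _ ([set x | f x <> x] `|` [set x | g x <> x])%classic);
  last by rewrite finite_setU.
move=> x fgx; have [gx|] := pselect (g x = x); last by right.
left => fx; apply: fgx.
by rewrite [LHS]symgrpME -[X in g^-1 X]gx symgrpK.
Qed.

HB.instance Definition _ (T : choiceType) :=
  SubChoice_isSubGroup.Build (symgrp T) (@finitary T) (fsymgrp T)
    (@finitary_closed T).

(* nat and 'I_n, whose numbering starts from 0, stand for the index sets
   {1, 2, ...} and {1, ..., n}; shifting by one commutes with translations. *)

Definition S_infinity : groupType := fsymgrp nat.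

Definition houghton (n : nat) (f : symgrp ('I_n * nat)%type) : bool :=
  `[< exists t : 'I_n -> int, forall j : 'I_n, exists s0 : nat, forall s : nat,
        (s0 <= s)%N ->
        (f (j, s)).1 = j /\ ((f (j, s)).2%:Z = s%:Z + t j)%R >].

Record Houghton (n : nat) :=
  HoughtonElt { houghton_val :> symgrp ('I_n * nat)%type;
                _ : houghton houghton_val }.

HB.instance Definition _ (n : nat) := [isSub for @houghton_val n].
HB.instance Definition _ (n : nat) := [Choice of Houghton n by <:].

Lemma houghton_closed (n : nat) : group_closed (@houghton n).
Proof.
split=> [|f g /asboolP[t ft] /asboolP[t' gt]]; apply/asboolP.
  by exists (fun=> 0%R) => j; exists 0%N => s _; rewrite symgrp1E GRing.addr0.
exists (fun j => t j - t' j)%R => j.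
have [a fa] := ft j; have [b gb] := gt j.
exists (a + b + `|t' j|)%N => s les.
have [s' [as' bs' es']] : exists s' : nat,
    [/\ (a <= s')%N, (b <= s')%N & (s'%:Z + t' j = s%:Z)%R].
  by exists (absz (s%:Z - t' j)%R); split; lia.
have gs' : g (j, s') = (j, s).
  case: (gb s' bs'); case: (g (j, s')) => j' r /= -> re.
  by congr (_, _); move: re; rewrite es' => -[].
have [f1 f2] := fa s' as'.
rewrite symgrpME -gs' symgrpK f2 /=; split=> //.
by lia.
Qed.

HB.instance Definition _ (n : nat) :=
  SubChoice_isSubGroup.Build (symgrp ('I_n * nat)%type) (@houghton n)
    (Houghton n) (@houghton_closed n).

(* The free group on X: reduced words, a letter (x, b) standing for x if
   b = false and for x^-1 if b = true. *)

Section FreeGroup.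
Variable X : choiceType.

Let letter := (X * bool)%type.
Implicit Types (l : letter) (u v w : seq letter).

Definition inv_letter l : letter := (l.1, ~~ l.2).

Definition reduced w : bool := sorted (fun l m => m != inv_letter l) w.

Record freegrp := FreeGrp { word :> seq letter; _ : reduced word }.

HB.instance Definition _ := [isSub for word].
HB.instance Definition _ := [Choice of freegrp by <:].

Definition cons_red l w : seq letter :=
  if w is m :: w' then if m == inv_letter l then w' else l :: w else [:: l].

Definition mul_word u v : seq letter := foldr cons_red v u.

Definition inv_word u : seq letter := rev (map inv_letter u).

Lemma inv_letterK : involutive inv_letter.
Proof. by case=> x b; rewrite /inv_letter /= negbK. Qed.

Lemma reduced_cons l w : reduced (l :: w) -> reduced w.
Proof. by case: w => //= m w /andP[]. Qed.

Lemma cons_red_reduced l w : reduced w -> reduced (cons_red l w).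
Proof.
case: w => //= m w; case: eqP => [_|/eqP ml mw]; first exact: (@reduced_cons m).
by rewrite /= ml.
Qed.

Lemma cons_redE l w : reduced (l :: w) -> cons_red l w = l :: w.
Proof. by case: w => //= m w /andP[/negPf->]. Qed.

Lemma cons_redK l w : reduced w -> cons_red l (cons_red (inv_letter l) w) = w.
Proof.
case: w => [|m w] rw /=; first by rewrite eqxx.
rewrite inv_letterK; case: eqP => [ml|_]; last by rewrite /= eqxx.
by rewrite -ml cons_redE.
Qed.

Lemma cons_redVK l w : reduced w -> cons_red (inv_letter l) (cons_red l w) = w.
Proof. by move=> /(cons_redK (inv_letter l)); rewrite inv_letterK. Qed.

Lemma mul_word_reduced u v : reduced v -> reduced (mul_word u v).
Proof. by move=> rv; elim: u => //= l u; exact: cons_red_reduced. Qed.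

Lemma mul_word_cons_red l u v : reduced v ->
  mul_word (cons_red l u) v = cons_red l (mul_word u v).
Proof.
case: u => //= m u rv; case: eqP => [->|//]; rewrite cons_redK//.
exact: mul_word_reduced.
Qed.

Lemma mul_wordA u v w : reduced w ->
  mul_word u (mul_word v w) = mul_word (mul_word u v) w.
Proof. by move=> rw; elim: u => //= l u ->; rewrite mul_word_cons_red. Qed.

Lemma mul_wordw0 u : reduced u -> mul_word u [::] = u.
Proof.
by elim: u => //= l u IH rlu; rewrite IH ?cons_redE//; exact: reduced_cons rlu.
Qed.

Lemma inv_wordK : involutive inv_word.
Proof. by move=> u; rewrite /inv_word map_rev revK mapK//; exact: inv_letterK. Qed.

Lemma inv_word_reduced u : reduced u -> reduced (inv_word u).
Proof.
rewrite /reduced /inv_word rev_sorted sorted_map; apply: sub_sorted => l m /=.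
by apply: contra => /eqP ->; rewrite inv_letterK eqxx.
Qed.

Lemma mul_wordVw u : reduced u -> mul_word (inv_word u) u = [::].
Proof.
elim: u => //= l u IH rlu; rewrite /inv_word /= rev_cons /mul_word foldr_rcons.
rewrite /= inv_letterK eqxx; apply: IH; exact: reduced_cons rlu.
Qed.

Lemma word_reduced (u : freegrp) : reduced u. Proof. by case: u. Qed.

Definition free1 : freegrp := @FreeGrp [::] isT.
Definition freeM (u v : freegrp) : freegrp :=
  FreeGrp (mul_word_reduced u (word_reduced v)).
Definition freeV (u : freegrp) : freegrp :=
  FreeGrp (inv_word_reduced (word_reduced u)).

Lemma freeMA : associative freeM.
Proof. by move=> u v w; apply/val_inj/mul_wordA/word_reduced. Qed.
Lemma free1M : left_id free1 freeM. Proof. by move=> u; apply/val_inj. Qed.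
Lemma freeM1 : right_id free1 freeM.
Proof. by move=> u; apply/val_inj/mul_wordw0/word_reduced. Qed.
Lemma freeVM : left_inverse free1 freeV freeM.
Proof. by move=> u; apply/val_inj/mul_wordVw/word_reduced. Qed.
Lemma freeMV : right_inverse free1 freeV freeM.
Proof.
move=> u; apply/val_inj => /=; rewrite -{1}[word u]inv_wordK.
exact/mul_wordVw/inv_word_reduced/word_reduced.
Qed.

HB.instance Definition _ := isGroup.Build freegrp freeMA free1M freeM1 freeVM freeMV.

Definition freegen (x : X) : freegrp := @FreeGrp [:: (x, false)] isT.

Section Lift.
Variables (G : groupType) (h : X -> G).

Definition eval_letter l : G := if l.2 then (h l.1)^-1 else h l.1.

Definition eval_word w : G := \prod_(l <- w) eval_letter l.

Definition freelift (u : freegrp) : G := eval_word u.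

Lemma eval_inv_letter l : eval_letter (inv_letter l) = (eval_letter l)^-1.
Proof. by case: l => x [] //=; rewrite /eval_letter /= invgK. Qed.

Lemma eval_cons_red l w :
  eval_word (cons_red l w) = eval_letter l * eval_word w.
Proof.
rewrite /eval_word; case: w => [|m w] /=; first by rewrite big_cons.
case: eqP => [->|_]; rewrite !big_cons//.
by rewrite eval_inv_letter mulVKg.
Qed.

Lemma freeliftM : {morph freelift : u v / u * v}.
Proof.
move=> u v; rewrite /freelift /=; elim: (word u) => [|l w IH] /=.
  by rewrite {2}/eval_word big_nil mul1g.
by rewrite eval_cons_red IH {3}/eval_word big_cons mulgA.
Qed.

Lemma freelift_gen x : freelift (freegen x) = h x.
Proof. by rewrite /freelift /eval_word big_seq1. Qed.

End Lift.

Lemma freegrp_ext (G : groupType) (f g : freegrp -> G) :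
  {morph f : u v / u * v} -> {morph g : u v / u * v} ->
  (forall x, f (freegen x) = g (freegen x)) -> f =1 g.
Proof.
move=> fM gM fg.
have [f1 g1] := (morph_group1 fM, morph_group1 gM).
have [fV gV] := (morph_groupV fM, morph_groupV gM).
case=> w; elim: w => [|l w IH] rlw.
  by rewrite (_ : FreeGrp _ = 1) ?f1 ?g1//; exact: val_inj.
pose L := @FreeGrp [:: l] isT.
have -> : FreeGrp rlw = L * FreeGrp (reduced_cons rlw).
  by apply/val_inj; rewrite /= cons_redE.
rewrite fM gM IH; congr (_ * _); case: l @L {rlw} => x [] L; last first.
  by rewrite (_ : L = freegen x) //; exact: val_inj.
by rewrite (_ : L = (freegen x)^-1) ?fV ?gV ?fg//; exact: val_inj.
Qed.

End FreeGroup.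

Section PureSymmetric.
Variable n : nat.

Let F : groupType := freegrp 'I_n.
Let x (i : 'I_n) : F := freegen i.

Definition alpha_fun (i j : 'I_n) : F -> F :=
  freelift (fun k => if k == i then x j * x i * (x j)^-1 else x k).

Definition alpha_inv (i j : 'I_n) : F -> F :=
  freelift (fun k => if k == i then (x j)^-1 * x i * x j else x k).

Lemma alpha_funM i j : {morph alpha_fun i j : u v / u * v}.
Proof. exact: freeliftM. Qed.

Lemma alpha_invM i j : {morph alpha_inv i j : u v / u * v}.
Proof. exact: freeliftM. Qed.

Lemma alpha_funK i j : cancel (alpha_fun i j) (alpha_inv i j).
Proof.
apply: freegrp_ext => [u v|//|k]; first by rewrite alpha_funM alpha_invM.
rewrite {1}/alpha_fun freelift_gen; case: eqVneq => [->|ki]; last first.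
  by rewrite /alpha_inv freelift_gen (negPf ki).
have aV := morph_groupV (alpha_invM i j).
rewrite !alpha_invM aV /alpha_inv !freelift_gen eqxx.
case: eqVneq => [->|_]; first by rewrite mulVg mul1g mulgK.
by rewrite !mulgA mulgV mul1g mulgK.
Qed.

Lemma alpha_invK i j : cancel (alpha_inv i j) (alpha_fun i j).
Proof.
apply: freegrp_ext => [u v|//|k]; first by rewrite alpha_invM alpha_funM.
rewrite {1}/alpha_inv freelift_gen; case: eqVneq => [->|ki]; last first.
  by rewrite /alpha_fun freelift_gen (negPf ki).
have aV := morph_groupV (alpha_funM i j).
rewrite !alpha_funM aV /alpha_fun !freelift_gen eqxx.
case: eqVneq => [->|_]; first by rewrite mulgK mulVg mul1g.
by rewrite !mulgA mulVg mul1g mulgVK.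
Qed.

(* For i = j this is the identity; only i != j is used below. *)
Definition alpha (i j : 'I_n) : autgrp F :=
  @AutGrp F (symgrp_of (Bijective (@alpha_funK i j) (@alpha_invK i j)))
    (asboolT (@alpha_funM i j)).

Lemma alphaE i j k :
  alpha i j (freegen k) = if k == i then x j * x i * (x j)^-1 else x k.
Proof. by rewrite /= /alpha_fun freelift_gen. Qed.

Definition pure_symmetric_gens : set (autgrp F) :=
  [set a | exists i j : 'I_n, i != j /\ a = alpha i j].

Definition pure_symmetric_aut : groupType := gengrp pure_symmetric_gens.

End PureSymmetric.

(* Main.v *)
Require Import Defs.
From HB Require Import structures.
From mathcomp Require Import all_boot all_order ssralg ssrnum ssrint zify.
From mathcomp Require Import ring algC boolp classical_sets cardinality.

(** Every automorphism of a group of permutations of an infinite set X which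
    contains the finitary permutations is conjugation by a permutation f of X,
    because the transpositions t are the involutions with (t t^g)^6 = 1 for all
    g.  Twisted classes are thus conjugacy classes in a coset of f.  For S_oo
    they are separated by the number of fixed points relative to f; for H_n, by
    the lengths of finite cycles, as f and all elements of its coset eventually
    map rays into rays increasingly, which leaves only
    finitely many lengths for each element.

    For n >= 2, killing the generators x_k with k <> i, j gives p_ij from G_n
    onto Inn(F_2) = F_2.  In F_2 an element commuting with two noncommuting ones
    is trivial, so McCool's relations force a homomorphism G_n -> F_2 with
    nonabelian image to kill either all alpha_xy with {x,y} <> {k,l} for some k, l,
    or enough generators to factor through the outer group of F(x_a,x_b,x_c).
    The second case is impossible for p_ij o phi: the three classes of H^1(G_n)
    attached to a, b, c have vanishing products on commuting pairs, whereas the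
    two classes of p_ij lie in no larger space with this property.  Hence phi
    permutes the kernels of the p_ij, and a cycle of this permutation reduces
    the claim to a surjective endomorphism Psi of F_2.

    If the matrix M of Psi on Z^2 has eigenvalue 1, twisted classes are infinite
    in number already on an eigencharacter.  Otherwise Psi-conjugating elements of
    the commutator subgroup F' takes place in F', and F'/F'' = Z[Z^2] maps to
    k[e,d]/(e^2,d^2), on which Psi acts as u * sigma with sigma(e) = l e,
    sigma(d) = m d, where l, m are the eigenvalues of M and u has constant term
    l m = det M = 1 or -1.  The constant coefficient, resp. the coefficient of e d,
    is then invariant. *)

Set Implicit Arguments.
Unset Strict Implicit.
Unset Printing Implicit Defensive.
Import GRing.Theory Num.Theory.
Local Open Scope group_scope.

(** * Permutation groups *)

Lemma finite_nat_ubound (K : set nat) :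
  finite_set K -> exists N, forall k, K k -> k < N.
Proof.
move=> /finite_seqP[s ->]; exists (\max_(i <- s) i).+1 => k /= ks.
by rewrite ltnS; apply: leq_bigmax_seq.
Qed.

(** The values occurring on a class are those of any representative, so finitely many classes would
    leave finitely many values. [P] is a relation because cycle lengths attach several values to one
    element. *)
Lemma infinite_twisted_classes (G : groupType) (phi : autgrp G)
    (P : G -> nat -> Prop) :
  (forall x y k, twisted_conj phi x y -> P x k -> P y k) ->
  (forall x, finite_set [set k | P x k]) ->
  (forall N, exists2 k, N <= k & exists x, P x k) ->
  infinite_set (twisted_classes phi).
Proof.
move=> Pinv Pfin Punb fin.
have : finite_set (\bigcup_(C in twisted_classes phi)
                     [set k | exists2 x, C x & P x k])%classic.
  apply: bigcup_finite => // _ [x0 _ <-].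
  apply: sub_finite_set (Pfin x0) => k [x xC xk].
  by apply: Pinv xk; exact: twisted_conj_sym.
move=> /finite_nat_ubound[N ltN]; have [k leNk [x xk]] := Punb N.
suff : k < N by rewrite ltnNge leNk.
apply: ltN; exists (twisted_class phi x); first by exists x.
by exists x => //; exact: twisted_conj_refl.
Qed.

Lemma infinite_notin (T : choiceType) (A : set T) (s : seq T) :
  infinite_set A -> exists2 x, A x & x \notin s.
Proof.
move=> Ainf; apply: contrapT => nex; apply: Ainf.
apply: sub_finite_set (finite_seq s) => x Ax /=.
by apply: contrapT => /negP xs; apply: nex; exists x.
Qed.

Lemma infinite_uniq (T : choiceType) (A : set T) n : infinite_set A ->
  exists s : seq T, [/\ uniq s, size s = n & forall x, x \in s -> A x].
Proof.
move=> Ainf; elim: n => [|n [s [us <- sA]]]; first by exists [::].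
have [x Ax xs] := infinite_notin s Ainf.
by exists (x :: s); split=> //= [|y]; rewrite ?xs // inE => /predU1P[->|/sA].
Qed.

Lemma expg6_sq (G : groupType) (x : G) : x * x = 1 -> x ^+ 6 = 1.
Proof. by move=> xx; rewrite !expgS expg0 mulg1 !mulgA !(xx, mul1g). Qed.

Lemma expg6_cube (G : groupType) (x : G) : x * x * x = 1 -> x ^+ 6 = 1.
Proof. by move=> xxx; rewrite !expgS expg0 mulg1 !mulgA xxx mul1g xxx. Qed.

(** * Transpositions and their products *)

Section Swap.
Variable X : choiceType.
Implicit Types (a b c d p q x : X) (f g : symgrp X).

Definition swap_fun a b x := if x == a then b else if x == b then a else x.

Lemma swap_funK a b : involutive (swap_fun a b).
Proof.
move=> x; rewrite /swap_fun.
have [->|xa] := eqVneq x a; first by rewrite eqxx; case: eqP.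
have [->|xb] := eqVneq x b; first by rewrite eqxx.
by rewrite (negPf xa) (negPf xb).
Qed.

Definition swap a b : symgrp X := symgrp_of (inv_bij (swap_funK a b)).

Lemma swapE a b x : swap a b x = if x == a then b else if x == b then a else x.
Proof. by []. Qed.

Lemma swapL a b : swap a b a = b. Proof. by rewrite swapE eqxx. Qed.

Lemma swapR a b : swap a b b = a.
Proof. by rewrite swapE eqxx; case: eqP. Qed.

Lemma swapD a b x : x != a -> x != b -> swap a b x = x.
Proof. by rewrite swapE => /negPf-> /negPf->. Qed.

Lemma swapC a b : swap a b = swap b a.
Proof.
apply: symP => x; rewrite !swapE.
by case: eqVneq => [->|//]; case: eqVneq => // ->.
Qed.

Lemma swap2 a b : swap a b * swap a b = 1.
Proof. by apply: symP => x; exact: swap_funK. Qed.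

Lemma swap_conj f a b : f * swap a b * f^-1 = swap (f a) (f b).
Proof.
apply: symP => x; rewrite !symgrpME !swapE.
rewrite !(can2_eq (symgrpVK f) (symgrpK f)).
by case: eqP => // _; case: eqP => // _; rewrite symgrpVK.
Qed.

Lemma swap_neq1 a b : a != b -> swap a b <> 1.
Proof. by move=> ab /(congr1 (fun f : symgrp X => f b)) /eqP; rewrite swapR (negPf ab). Qed.

Lemma swap_inj a b c d : a != b -> swap a b = swap c d ->
  (a = c /\ b = d) \/ (a = d /\ b = c).
Proof.
move=> ab /(congr1 (fun f : symgrp X => f a)); rewrite swapL swapE.
case: eqP => [->|_]; first by left.
by case: eqP => [->|_]; [right|move/eqP; rewrite eq_sym (negPf ab)].
Qed.

Lemma swap_commute a b c d :
  a != c -> a != d -> b != c -> b != d -> commute (swap a b) (swap c d).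
Proof.
move=> ac ad bc bd.
rewrite /commute -[LHS](mulgVK (swap a b)) swap_conj.
by rewrite !swapD // eq_sym.
Qed.

(** Disjoint transpositions commute and so do equal ones, hence exactly one point [p] is shared. *)
Lemma swap_share a b c d : a != b -> c != d -> ~ commute (swap a b) (swap c d) ->
  exists p q r, [/\ swap a b = swap p q, swap c d = swap p r,
                    p != q, p != r & q != r].
Proof.
have aux u v w z : v != w -> v != z -> ~ commute (swap u v) (swap w z) ->
    u = w \/ u = z.
  move=> vw vz ncom; have [|uw] := eqVneq u w; first by left.
  by have [|uz] := eqVneq u z; [right | case: ncom; exact: swap_commute].
have eq_case u v w : u != v -> u != w -> ~ commute (swap u v) (swap u w) ->
    v != w.
  by move=> _ _ ncom; apply/eqP => vw; apply: ncom; rewrite vw.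
move=> ab cd ncom.
have [bc|bc] := eqVneq b c.
  rewrite -{}bc in cd ncom *; rewrite (swapC a) in ncom *.
  by exists b, a, d; rewrite cd eq_sym ab (eq_case b) // eq_sym.
have [bd|bd] := eqVneq b d.
  rewrite -{}bd in cd ncom bc *; rewrite (swapC a) (swapC c) in ncom *.
  by exists b, a, c; rewrite bc eq_sym ab (eq_case b) // eq_sym.
have [ac|ad] := aux a b c d bc bd ncom.
  rewrite -{}ac in cd ncom bc *.
  by exists a, b, d; rewrite ab cd (eq_case a).
rewrite -{}ad in cd ncom bd *; rewrite (swapC c) in ncom *.
rewrite eq_sym in cd.
by exists a, b, c; rewrite ab cd (eq_case a).
Qed.

(** The product has order 1 or 2 if the factors commute, and is a 3-cycle otherwise. *)
Lemma swap_mul_expg6 a b c d : (swap a b * swap c d) ^+ 6 = 1.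
Proof.
have [->|ab] := eqVneq a b.
  rewrite (_ : swap b b = 1); last by apply: symP => x; rewrite swapE; case: eqP.
  by rewrite mul1g expg6_sq ?swap2.
have [->|cd] := eqVneq c d.
  rewrite (_ : swap d d = 1); last by apply: symP => x; rewrite swapE; case: eqP.
  by rewrite mulg1 expg6_sq ?swap2.
have [com|ncom] := pselect (commute (swap a b) (swap c d)).
  by apply: expg6_sq; rewrite mulgA -[_ * swap a b]mulgA -com mulgA swap2 mul1g swap2.
have [p [q [r [-> -> pq pr qr]]]] := swap_share ab cd ncom.
apply/expg6_cube/symP => x.
rewrite !symgrpME symgrp1E.
have [e1 e2] := (swapL p q, swapR p q).
have [e3 e4] := (swapL p r, swapR p r).
have e5 : swap p q r = r by apply: swapD; rewrite eq_sym.
have e6 : swap p r q = q by apply: swapD => //; rewrite eq_sym.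
have [->|xp] := eqVneq x p; first by rewrite !(e1, e2, e3, e4, e5, e6).
have [->|xq] := eqVneq x q; first by rewrite !(e1, e2, e3, e4, e5, e6).
have [->|xr] := eqVneq x r; first by rewrite !(e1, e2, e3, e4, e5, e6).
by rewrite !(swapD xp).
Qed.

End Swap.

Definition swaplike (G : groupType) (t : G) : Prop :=
  [/\ t * t = 1, t <> 1 & forall g, (t * (g * t * g^-1)) ^+ 6 = 1].

Lemma swaplike_morph (G : groupType) (phi psi : G -> G) (t : G) :
    {morph phi : x y / x * y} -> cancel phi psi -> cancel psi phi ->
  swaplike t -> swaplike (phi t).
Proof.
move=> phiM phiK psiK [tt t1 t6].
have phi1 := morph_group1 phiM; have phiV := morph_groupV phiM.
split; first by rewrite -phiM tt.
  by rewrite -phi1 => /(can_inj phiK).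
move=> g; rewrite -[g]psiK -phiV -!phiM.
have phiX x n : phi (x ^+ n) = phi x ^+ n.
  by elim: n => [|n IH]; rewrite ?expg0 // !expgS phiM IH.
by rewrite -phiX t6.
Qed.

(** * Automorphisms of permutation groups containing all transpositions *)

Section PermutationGroupAut.
Variables (X : choiceType) (G : groupType) (iota : G -> symgrp X).
Hypothesis iotaM : {morph iota : x y / x * y}.
Hypothesis iota_inj : injective iota.
Hypothesis iota_swap : forall a b, exists t, iota t = swap a b.
Hypothesis X_infinite : infinite_set [set: X].

Let iota1 : iota 1 = 1. Proof. exact: morph_group1. Qed.
Let iotaV : {morph iota : x / x^-1}. Proof. exact: morph_groupV. Qed.
Let iotaX x n : iota (x ^+ n) = iota x ^+ n.
Proof. by elim: n => [|n IH]; rewrite ?expg0 // !expgS iotaM IH. Qed.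

(** An involution moving two disjoint pairs is excluded by a conjugate whose product with it
    contains a 5-cycle, or a 4-cycle if [t] has no fixed point. *)
Lemma swaplike_swap t : swaplike t <->
  exists a b, a != b /\ iota t = swap a b.
Proof.
split=> [[tt t1 t6]|[a [b [ab tab]]]]; last first.
  split=> [||g]; first by apply: iota_inj; rewrite iotaM tab swap2 iota1.
    by move=> t1; apply: (swap_neq1 ab); rewrite -tab t1 iota1.
  apply: iota_inj; rewrite iotaX !iotaM iotaV tab swap_conj.
  by rewrite swap_mul_expg6 iota1.
have tK : involutive (iota t).
  by move=> x; rewrite -symgrpME -iotaM tt iota1.
have move6 x y (g : symgrp X) : (exists h, iota h = g) -> x != y ->
    let s := iota t * (g * iota t * g^-1) in
    (s ^+ 6) x = y -> False.
  move=> [h <-] xy s; rewrite {}/s -iotaV -!iotaM -iotaX t6 iota1 symgrp1E.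
  by move/eqP; rewrite (negPf xy).
have iotaMex g h : (exists x, iota x = g) -> (exists x, iota x = h) ->
    exists x, iota x = g * h.
  by move=> [x <-] [y <-]; exists (x * y); rewrite iotaM.
have [a ta] : exists a, iota t a != a.
  apply: contrapT => nex; apply: t1; apply: iota_inj; rewrite iota1.
  by apply: symP => x; apply: contrapT => /eqP tx; apply: nex; exists x.
have [b ab] : exists b, iota t a = b by exists (iota t a).
have ba : iota t b = a by rewrite -ab tK.
rewrite ab eq_sym in ta.
exists a, b; split=> //; apply: symP => c0; apply: contrapT.
have [->|c0a] := eqVneq c0 a; first by rewrite swapL.
have [->|c0b] := eqVneq c0 b; first by rewrite swapR.
rewrite swapD // => /eqP tc0.
have [fixed|nofix] := pselect (exists e, iota t e = e).
  have [e ee] := fixed; set c := c0 in c0a c0b tc0 *.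
  have [d cd] : exists d, iota t c = d by exists (iota t c).
  have dc : iota t d = c by rewrite -cd tK.
  have ea : e != a by apply/eqP => E; move: ta; rewrite -ab -E ee eqxx.
  have eb : e != b by apply/eqP => E; move: ta; rewrite -ba -E !ee eqxx.
  have ec : e != c by apply/eqP => E; move: tc0; rewrite -/c -E ee eqxx.
  have ed : e != d by apply/eqP => E; move: tc0; rewrite -/c -dc -E !ee eqxx.
  have da : d != a by apply/eqP => E; move: c0b; rewrite -/c -dc E ab eqxx.
  have db : d != b by apply/eqP => E; move: c0a; rewrite -/c -dc E ba eqxx.
  have dc' : d != c by rewrite -cd.
  have neqs' := (negPf ea, negPf eb, negPf ec, negPf ed, negPf da, negPf db,
     negPf dc', negPf c0a, negPf c0b, negPf ta).
  have neqs2 : ((a == e) = false) * ((b == e) = false) * ((c == e) = false) *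
     ((d == e) = false) * ((a == d) = false) * ((b == d) = false) *
     ((c == d) = false) * ((a == c) = false) * ((b == c) = false) *
     ((b == a) = false).
    by do !split; rewrite eq_sym neqs'.
  (* [g] is the 3-cycle a -> c -> e -> a, so [iota t] times its conjugate by [g] has the 5-cycle a
     -> b -> d -> e -> c -> a, whose sixth power sends a to b. *)
  pose g := swap a c * swap c e.
  apply: (move6 a b g _ ta); first by apply: iotaMex; exact: iota_swap.
  have [gb gd] : g b = b /\ g d = d.
    by rewrite !symgrpME !swapE !(neqs', neqs2).
  have [ga gc ge] : [/\ g a = c, g c = e & g e = a].
    by split; rewrite !symgrpME !swapE !(eqxx, neqs', neqs2).
  have gV x y : g x = y -> g^-1 y = x by move=> <-; exact: symgrpK.
  have gVs := (gV _ _ ga, gV _ _ gb, gV _ _ gc, gV _ _ gd, gV _ _ ge).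
  clearbody g; rewrite !expgS expg0 !symgrpME symgrp1E.
  by do !rewrite ?(ab, ba, cd, dc, ee) ?(ga, gb, gc, gd, ge) ?gVs.
have tn x : iota t x != x by apply/eqP => tx; apply: nofix; exists x.
set c := c0 in c0a c0b tc0 *.
have [e _] := infinite_notin [:: a; b; c; iota t c] X_infinite.
rewrite !inE !negb_or => /and4P[ea eb ec ed].
have [h _] := infinite_notin [:: a; b; c; iota t c; e; iota t e] X_infinite.
rewrite !inE !negb_or => /and5P[ha hb hc hd /andP[he hf]].
have [d cd] : exists d, iota t c = d by exists (iota t c).
have [f ef] : exists f, iota t e = f by exists (iota t e).
have [k hk] : exists k, iota t h = k by exists (iota t h).
rewrite cd in ed hd; rewrite ef in hf.
have [dc fe kh] : [/\ iota t d = c, iota t f = e & iota t k = h].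
  by rewrite -cd -ef -hk !tK.
have tneq x y : iota t x != iota t y -> x != y by apply: contra => /eqP ->.
have da : d != a by apply: tneq; rewrite dc ab.
have dc' : d != c by rewrite -cd.
have de : d != e by rewrite eq_sym.
have dh : d != h by rewrite eq_sym.
have fa : f != a by apply: tneq; rewrite fe ab.
have fc : f != c by apply: tneq; rewrite fe cd.
have fe' : f != e by rewrite -ef.
have fh : f != h by rewrite eq_sym.
have ka : k != a by apply: tneq; rewrite kh ab.
have kc : k != c by apply: tneq; rewrite kh cd.
have ke : k != e by apply: tneq; rewrite kh ef.
have kh' : k != h by rewrite -hk.
have ba' : b != a by rewrite eq_sym.
have bc : b != c by rewrite eq_sym.
have be : b != e by rewrite eq_sym.
have bh : b != h by rewrite eq_sym.
have ae : a != e by rewrite eq_sym.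
have neqs := (negPf da, negPf dc', negPf de, negPf dh, negPf fa, negPf fc,
  negPf fe', negPf fh, negPf ka, negPf kc, negPf ke, negPf kh').
have neqs' := (negPf ba', negPf bc, negPf be, negPf bh).
have neqs2 := (negPf ea, negPf ec, negPf ha, negPf hc, negPf he, negPf c0a).
have neqs3 : ((a == e) = false) * ((c == e) = false) * ((a == h) = false) *
     ((c == h) = false) * ((e == h) = false) * ((a == c) = false).
  by do !split; rewrite eq_sym neqs2.
(* [g] is the 4-cycle a -> c -> e -> h -> a. The product now has the 4-cycle a -> h -> e -> c -> a,
   whose sixth power is its square and sends a to e. *)
pose g := swap a c * (swap c e * swap e h).
apply: (move6 a e g _ ae).
  by apply: (iotaMex); [|apply: iotaMex]; exact: iota_swap.
have [gb gd gf gk] : [/\ g b = b, g d = d, g f = f & g k = k].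
  by split; rewrite !symgrpME !swapE !(neqs, neqs').
have [ga gc ge gh] : [/\ g a = c, g c = e, g e = h & g h = a].
  by split; rewrite !symgrpME !swapE !(eqxx, neqs2, neqs3).
have gV x y : g x = y -> g^-1 y = x by move=> <-; exact: symgrpK.
have gVs := (gV _ _ ga, gV _ _ gb, gV _ _ gc, gV _ _ gd, gV _ _ ge,
             gV _ _ gf, gV _ _ gh, gV _ _ gk).
clearbody g; rewrite !expgS expg0 !symgrpME symgrp1E.
by do !rewrite ?(ab, ba, cd, dc, ef, fe, hk, kh)
  ?(ga, gb, gc, gd, ge, gf, gh, gk) ?gVs.
Qed.

Theorem aut_conj_by_permutation (phi : autgrp G) :
  exists f : symgrp X, forall g, iota (phi g) = f * iota g * f^-1.
Proof.
have phiM := autgrpM phi; have phiV := morph_groupV phiM.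
have [phiK phiVK] := (symgrpK phi, symgrpVK phi).
have phi_inj := can_inj phiK.
pose sw a b := sval (cid (iota_swap a b)).
have swE a b : iota (sw a b) = swap a b by rewrite /sw; case: cid.
have sw_swap a b : a != b -> exists p q, p != q /\ iota (phi (sw a b)) = swap p q.
  move=> ab; apply/swaplike_swap/(swaplike_morph phiM phiK phiVK)/swaplike_swap.
  by exists a, b.
have com_phi a b c d : commute (iota (phi (sw a b))) (iota (phi (sw c d))) ->
    commute (swap a b) (swap c d).
  by rewrite /commute -!iotaM -!phiM => /iota_inj/phi_inj; rewrite -!swE -!iotaM => ->.
have phi_sw_inj a b c d : iota (phi (sw a b)) = iota (phi (sw c d)) ->
    swap a b = swap c d.
  by move=> /iota_inj/phi_inj; rewrite -!swE => ->.
have ncom3 (a b c : X) : a != b -> a != c -> b != c -> ~ commute (swap a b) (swap a c).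
  move=> ab ac bc E; have : swap a b (swap a c a) = swap a c (swap a b a).
    by rewrite -!symgrpME E.
  rewrite !swapL !swapE !(eq_sym _ a) (negPf ab) (negPf ac) (eq_sym c).
  by rewrite (negPf bc) => cb; rewrite cb eqxx in bc.
have other (s : seq X) : exists x, x \notin s.
  by have [x _ xs] := infinite_notin s X_infinite; exists x.
(* The images of the transpositions moving [a] pairwise fail to commute. The point [p] common to two
   of them lies in all of them and becomes the value at [a] of the conjugating permutation. *)
have center : forall a, {p | forall b, b != a ->
    exists2 q, q != p & iota (phi (sw a b)) = swap p q}.
  move=> a; apply: cid.
  have [b] := other [:: a]; rewrite inE => ba.
  have [c] := other [:: a; b]; rewrite !inE negb_or => /andP[ca cb].
  rewrite eq_sym in ba; rewrite eq_sym in ca; rewrite eq_sym in cb.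
  have [p0 [q0 [pq0 Eb]]] := sw_swap _ _ ba.
  have [p1 [q1 [pq1 Ec]]] := sw_swap _ _ ca.
  have := swap_share pq0 pq1; rewrite -Eb -Ec.
  move=> /(_ (fun C => ncom3 _ _ _ ba ca cb (com_phi _ _ _ _ C))).
  move=> [p [q [r [{}Eb {}Ec pq pr qr]]]].
  exists p => d da.
  have [->|db] := eqVneq d b; first by exists q; rewrite 1?eq_sym.
  have [->|dc] := eqVneq d c; first by exists r; rewrite 1?eq_sym.
  rewrite eq_sym in da; rewrite eq_sym in db; rewrite eq_sym in dc.
  have [m [n [mn Ed]]] := sw_swap _ _ da.
  have [mp|mp] := eqVneq m p; first by rewrite mp in mn Ed; exists n; rewrite // eq_sym.
  have [np|np] := eqVneq n p; first by rewrite np in mn Ed; exists m; rewrite // Ed swapC.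
  have ncomb : ~ commute (swap m n) (swap p q).
    by rewrite -Ed -Eb => /com_phi; apply: ncom3; rewrite // eq_sym.
  have ncomc : ~ commute (swap m n) (swap p r).
    by rewrite -Ed -Ec => /com_phi; apply: ncom3; rewrite // eq_sym.
  have in_mn x : ~ commute (swap m n) (swap p x) -> x = m \/ x = n.
    move=> ncom; have [->|xm] := eqVneq x m; first by left.
    have [->|xn] := eqVneq x n; first by right.
    by case: ncom; apply: swap_commute; rewrite // eq_sym.
  (* A transposition meeting (p q) and (p r) but avoiding p is (q r), which
     is the image of (b c). *)
  have Eqr : swap m n = swap q r.
    have [qm|qn] := in_mn q ncomb; have [rm|rn] := in_mn r ncomc; subst.
    - by rewrite eqxx in qr.
    - by [].
    - by rewrite swapC.
    - by rewrite eqxx in qr.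
  have : swap a d = swap b c.
    apply: phi_sw_inj; rewrite Ed Eqr.
    have -> : sw b c = sw a b * sw a c * (sw a b)^-1.
      apply: iota_inj; rewrite !iotaM iotaV !swE swap_conj swapL.
      by rewrite swapD // eq_sym.
    rewrite !phiM phiV !iotaM iotaV Eb Ec swap_conj swapL.
    by rewrite swapD // eq_sym.
  by move=> /(swap_inj da)[[/eqP]|[/eqP]]; rewrite ?(negPf ba) ?(negPf ca).
pose f a := sval (center a).
have fP a b : b != a -> exists2 q, q != f a & iota (phi (sw a b)) = swap (f a) q.
  exact: (svalP (center a)).
have swC a b : sw a b = sw b a by apply: iota_inj; rewrite !swE swapC.
(* If [f a = f b], the commuting transpositions (a c) and (b d) have images sharing the point [f a];
   these commute only if they are equal, but (a c) and (b d) differ. *)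
have f_inj : injective f.
  move=> a b fab; apply: contrapT => /eqP ab.
  have [c] := other [:: a; b]; rewrite !inE negb_or => /andP[ca cb].
  have [d] := other [:: a; b; c]; rewrite !inE !negb_or => /and3P[da db dc].
  have [q qa Ec] := fP a c ca; have [r rb Ed] := fP b d db.
  have com : commute (swap a c) (swap b d).
    by apply: swap_commute; rewrite // eq_sym.
  have : commute (swap (f a) q) (swap (f b) r).
    by rewrite -Ec -Ed /commute -!iotaM -!phiM; congr (iota (phi _));
       apply: iota_inj; rewrite !iotaM !swE.
  rewrite -fab in rb Ed *; rewrite eq_sym in qa; rewrite eq_sym in rb.
  have [qr _|qr /ncom3] := eqVneq q r; last by apply.
  move: Ec; rewrite qr -Ed => /phi_sw_inj /swap_inj; rewrite eq_sym => /(_ ca).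
  by move=> [[/eqP]|[/eqP]]; rewrite ?(negPf ab) // eq_sym (negPf da).
have fE a b : a != b -> iota (phi (sw a b)) = swap (f a) (f b).
  move=> ab; have ba : b != a by rewrite eq_sym.
  have [q qa E] := fP a b ba; have [r rb E'] := fP b a ab.
  rewrite swC E' in E; rewrite eq_sym in rb.
  have [[/f_inj/eqP]|[qb ra]] := swap_inj rb E; first by rewrite (negPf ba).
  by rewrite swC E' ra swapC.
have f_surj p : exists a, f a = p.
  have [q] := other [:: p]; rewrite inE => qp; rewrite eq_sym in qp.
  have : swaplike ((phi : symgrp G)^-1 (sw p q)).
    apply: (swaplike_morph _ phiVK phiK); last by apply/swaplike_swap; exists p, q.
    by move=> x y; apply: phi_inj; rewrite phiM !phiVK.
  move=> /swaplike_swap[a [b [ab E]]].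
  have : iota (phi (sw a b)) = swap p q.
    by rewrite -swE -[sw p q]phiVK; congr (iota (phi _)); apply: iota_inj; rewrite swE.
  rewrite fE // => /swap_inj[|[<- _]|[_ <-]]; last 2 first.
  - by exists a.
  - by exists b.
  - by apply: contra ab => /eqP/f_inj ->.
pose f' p := sval (cid (f_surj p)).
have f'K : cancel f' f by move=> p; rewrite /f'; case: cid.
have fK : cancel f f' by move=> a; apply: f_inj; rewrite f'K.
exists (symgrp_of (Bijective fK f'K)) => g.
set F := symgrp_of _.
rewrite -[LHS](mulgK F); congr (_ * _).
suff E a : iota (phi g) (f a) = f (iota g a).
  by apply: symP => p; rewrite !symgrpME; exact: E.
have [b] := other [:: a]; rewrite inE => ba.
have [c] := other [:: a; b]; rewrite !inE negb_or => /andP[ca cb].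
(* The conjugate of (a x) by [g] is the transposition of its images; applying [phi] leaves two
   candidates for the image of [f a]. Two different choices of [x] single out the first. *)
have im x : x != a ->
    iota (phi g) (f a) = f (iota g a) \/ iota (phi g) (f a) = f (iota g x).
  move=> xa; have ax : a != x by rewrite eq_sym.
  have gax : iota g a != iota g x.
    by apply: contra ax => /eqP/(can_inj (symgrpK (iota g))) ->.
  have := fE _ _ gax.
  have -> : sw (iota g a) (iota g x) = g * sw a x * g^-1.
    by apply: iota_inj; rewrite !iotaM iotaV !swE swap_conj.
  rewrite !phiM phiV !iotaM iotaV fE // swap_conj => /swap_inj[|[-> _]|[-> _]].
  - by apply: contra ax => /eqP/(can_inj (symgrpK (iota (phi g))))/f_inj ->.
  - by left.
  - by right.
have [//|Eb] := im b ba; have [//|Ec] := im c ca.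
move: cb; rewrite Eb in Ec; move/f_inj/(can_inj (symgrpK (iota g))): Ec => ->.
by rewrite eqxx.
Qed.

End PermutationGroupAut.

Section FinitaryExtension.
Variable X : choiceType.

(** The permutation [x] obtained for the tails is corrected by the transposition of [x a] and [b],
    which does not touch the values on the tail. *)
Lemma finitary_extension (s t : seq X) : uniq s -> uniq t -> size s = size t ->
  exists2 x : symgrp X, map x s = t &
    forall p, p \notin s -> p \notin t -> x p = p.
Proof.
elim: s t => [|a s IH] [|b t] //=; first by exists 1.
move=> /andP[as_ us] /andP[bt ut] [/(IH t us ut)[x xst xfix]].
have x_inj : injective x := can_inj (symgrpK x).
exists (swap (x a) b * x) => [|p].
  rewrite symgrpME swapL; congr (_ :: _); rewrite -xst.
  apply/eq_in_map => c cs; rewrite symgrpME swapD //.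
    by rewrite inj_eq //; apply: contraNneq as_ => <-.
  by apply: contraNneq bt => <-; rewrite -xst map_f.
rewrite !inE !negb_or => /andP[pa ps] /andP[pb pt].
rewrite symgrpME (xfix p) // swapD //.
by apply: contra pa; rewrite -{1}(xfix p) // => /eqP/x_inj ->.
Qed.

Lemma finitaryP (x : symgrp X) :
  finitary x <-> exists E : seq X, forall p, p \notin E -> x p = p.
Proof.
split=> [/asboolP/finite_seqP[E xE]|[E xE]].
  exists E => p pE; apply: contrapT => xp.
  have : [set p | x p <> p]%classic p by [].
  by rewrite xE /= (negPf pE).
apply/asboolP; apply: sub_finite_set (finite_seq E) => p /= xp.
by apply: contrapT => /negP/xE.
Qed.

Lemma finitary_swap (a b : X) : finitary (swap a b).
Proof.
apply/finitaryP; exists [:: a; b] => p; rewrite !inE negb_or => /andP[pa pb].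
exact: swapD.
Qed.

End FinitaryExtension.

(** * The index of fixed points, and finitary symmetric groups *)

Section FixedPointIndex.
Variable X : choiceType.
Implicit Types (E : seq X) (f g h : symgrp X).

Definition fixcount h E := count (fun p => h p == p) E.

(* The index of fixed points of h relative to f, up to sign; it is computed on
   any finite set off which h and f agree. *)
Definition fixdist f h (k : nat) : Prop :=
  exists E, [/\ uniq E, forall p, p \notin E -> h p = f p &
    k = (fixcount h E - fixcount f E) + (fixcount f E - fixcount h E)].

(** Enlarging [E] adds the same fixed points to both counts. The additive form avoids truncated
    subtraction. *)
Lemma fixcount_sub f h E E' : uniq E -> uniq E' -> {subset E <= E'} ->
    (forall p, p \notin E -> h p = f p) ->
  fixcount h E' + fixcount f E = fixcount f E' + fixcount h E.
Proof.
move=> uE uE' EE' hf; have : perm_eq E' (E ++ [seq p <- E' | p \notin E]).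
  apply: uniq_perm => //.
    rewrite cat_uniq uE filter_uniq // andbT; apply/hasPn => p.
    by rewrite mem_filter => /andP[].
  move=> p; rewrite mem_cat mem_filter.
  by case: (boolP (p \in E)) => [/EE'->|].
rewrite /fixcount => /permP pE; rewrite !pE !count_cat.
have -> : count (fun p => h p == p) [seq p <- E' | p \notin E] =
          count (fun p => f p == p) [seq p <- E' | p \notin E].
  by apply: eq_in_count => p; rewrite mem_filter => /andP[/hf -> _].
by rewrite addnAC [RHS]addnC addnA.
Qed.

Lemma fixdist_uniq f h k k' : fixdist f h k -> fixdist f h k' -> k = k'.
Proof.
move=> [E [uE hE ->]] [E' [uE' hE' ->]].
have sub1 : {subset E <= undup (E ++ E')}.
  by move=> p pE; rewrite mem_undup mem_cat pE.
have sub2 : {subset E' <= undup (E ++ E')}.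
  by move=> p pE; rewrite mem_undup mem_cat pE orbT.
have := fixcount_sub uE (undup_uniq _) sub1 hE.
have := fixcount_sub uE' (undup_uniq _) sub2 hE'.
by lia.
Qed.

Lemma fixcount_conj g h E : uniq E -> (forall p, p \notin E -> g p = p) ->
  fixcount (g * h * g^-1) E = fixcount h E.
Proof.
move=> uE gE; have g_inj : injective g := can_inj (symgrpK g).
have gP p : (g p \in E) = (p \in E).
  have [pE|pE] := boolP (p \in E); last by rewrite gE // (negPf pE).
  apply: contrapT => /negP gpE.
  by have := gE _ gpE => /g_inj E2; rewrite E2 pE in gpE.
have pE : perm_eq E (map g E).
  apply: uniq_perm => //; first by rewrite map_inj_uniq.
  by move=> p; rewrite -{2}[p](symgrpVK g) mem_map // -[RHS]gP symgrpVK.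
rewrite /fixcount (permP pE) count_map; apply: eq_count => p /=.
by rewrite symgrpK (inj_eq g_inj).
Qed.

Lemma fixdist_conj f g h k : finitary g -> fixdist f h k ->
  fixdist f (g * h * g^-1) k.
Proof.
move=> /finitaryP[S gS] [E [uE hE ->]].
(* Off [E'] both [p] and [f p] are fixed by [g], so that the conjugate still agrees with [f]
   there. *)
pose E' := undup (E ++ S ++ map f^-1 S).
have uE' : uniq E' by exact: undup_uniq.
have EE' : {subset E <= E'} by move=> p pE; rewrite mem_undup !mem_cat pE.
have gE' p : p \notin E' -> g p = p.
  by rewrite mem_undup !mem_cat !negb_or => /and3P[_ pS _]; exact: gS.
exists E'; split=> // [p|].
  move=> pE'; rewrite !symgrpME -[X in g^-1 X](gE' p) // symgrpK.
  move: pE'; rewrite mem_undup !mem_cat !negb_or => /and3P[pE _ fpS].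
  rewrite hE // gS //; apply: contra fpS => fpS.
  by apply/mapP; exists (f p) => //; rewrite symgrpK.
rewrite fixcount_conj //.
by have := fixcount_sub uE uE' EE' hE; lia.
Qed.

(** If [f] has infinitely many fixed points, [x] destroys many of them by a cycle; otherwise [f]
    moves infinitely many points and [x] undoes [f] on many of them. *)
Lemma fixdist_unbounded f N : infinite_set [set: X] ->
  exists2 k, N <= k & exists x, finitary x /\ fixdist f (x * f) k.
Proof.
move=> Xinf; have f_inj : injective f := can_inj (symgrpK f).
have [fixinf|fixfin] := pselect (infinite_set [set p | f p = p]%classic).
  (* At least two points are taken, as rotating a single point would keep it fixed. *)
  have [s [us ss sfix]] := infinite_uniq N.+2 fixinf.
  have [x xs xfix] := @finitary_extension X s (rot 1 s) us
    (etrans (rot_uniq _ _) us) (esym (size_rot _ _)).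
  have xE p : p \notin s -> x p = p by move=> ps; apply: xfix; rewrite ?mem_rot.
  exists N.+2; first by lia.
  exists x; split; first by apply/finitaryP; exists s.
  exists s; split=> // [p ps|].
    rewrite symgrpME xE //; apply: contra ps => fps.
    by have /= /f_inj := sfix _ fps => E; rewrite -E.
  have -> : fixcount f s = N.+2.
    by rewrite -ss; apply/eqP; rewrite -all_count; apply/allP => p /sfix /= ->.
  suff -> : fixcount (x * f) s = 0 by [].
  apply/eqP; rewrite -leqn0 leqNgt -has_count; apply/hasPn => p ps.
  rewrite symgrpME (sfix p ps : f p = p).
  case: s us ss xs ps {sfix xfix xE} => // a s us ss xs /(nthP a)[i ilt <-].
  rewrite -(nth_map a a x) // xs rot1_cons -cats1 nth_cat.
  have [lti|lei] := ltnP i (size s).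
    by rewrite (nth_uniq a (s := a :: s) (i := i.+1)) // neq_ltn ltnSn orbT.
  have -> : i = size s by apply/eqP; rewrite eqn_leq lei -ltnS ilt.
  rewrite subnn (nth_uniq a (s := a :: s) (i := 0) (j := size s)) //.
  by move: ss => /= [->].
have nonfix : infinite_set [set p | f p <> p]%classic.
  move=> movfin; apply: Xinf.
  rewrite (_ : [set: X] = [set p | f p = p] `|` [set p | f p <> p])%classic.
    by rewrite finite_setU; split=> //; exact: contrapT.
  by apply/seteqP; split=> // p _; have [] := pselect (f p = p); [left|right].
have [s [us ss sfix]] := infinite_uniq N nonfix.
have [x xs xfix] := @finitary_extension X (map f s) s
  (etrans (map_inj_uniq f_inj _) us) us (size_map _ _).
(* [x] may also move points of [s] outside [f s], so [x * f] can differ from [f] on the preimage of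
   [s] as well. *)
pose E := undup (s ++ map f^-1 s).
have fE p : p \in E -> f p != p.
  rewrite mem_undup mem_cat => /orP[/sfix/eqP//|/mapP[q qs ->]].
  rewrite symgrpVK; apply/eqP => qE; apply: (sfix q qs).
  by rewrite {1}qE symgrpVK.
exists (fixcount (x * f) E).
  rewrite -ss /fixcount -size_filter; apply: uniq_leq_size => // p ps.
  rewrite mem_filter mem_undup mem_cat ps /= andbT.
  have /eq_in_map xfs : [seq x (f q) | q <- s] = [seq id q | q <- s].
    by rewrite map_id -[RHS]xs -map_comp.
  by rewrite xfs.
exists x; split; first by apply/finitaryP; exists (map f s ++ s) => p;
  rewrite mem_cat negb_or => /andP[]; exact: xfix.
exists E; split=> [|p|].
- exact: undup_uniq.
- rewrite mem_undup mem_cat negb_or => /andP[ps fps].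
  rewrite symgrpME xfix // ?mem_map //.
  by apply: contra fps => fps; apply/mapP; exists (f p); rewrite ?symgrpK.
suff -> : fixcount f E = 0 by rewrite subn0 sub0n addn0.
apply/eqP; rewrite -leqn0 leqNgt -has_count; apply/hasPn => p /fE; exact.
Qed.

End FixedPointIndex.

Lemma fsym_R_infinity (X : choiceType) : infinite_set [set: X] ->
  R_infinity_property (fsymgrp X).
Proof.
move=> Xinf phi.
have valM : {morph @fsymval X : x y / x * y} by [].
have val_swap (a b : X) : exists t : fsymgrp X, fsymval t = swap a b.
  by exists (FSymGrp (finitary_swap a b)).
have [f fP] := aut_conj_by_permutation valM val_inj val_swap Xinf phi.
apply: (@infinite_twisted_classes _ phi
  (fun x k => fixdist f (fsymval x * f) k)).
- move=> x y k [g ->] xk.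
  (* Since [phi] is conjugation by [f], multiplying g x phi(g)^-1 by [f] on the right gives g (x f)
     g^-1. *)
  rewrite !valM fP (morph_groupV valM) -!mulgA mulVg mulg1 !mulgA -(mulgA _ _ f).
  by apply: fixdist_conj => //; case: g.
- move=> x; have [[k xk]|nk] := pselect (exists k, fixdist f (fsymval x * f) k).
    apply: sub_finite_set (finite_set1 k) => k' /= xk'.
    exact: fixdist_uniq xk' xk.
  by apply: sub_finite_set (finite_set0 _) => k xk; apply: nk; exists k.
- move=> N; have [k leNk [x [xfin xk]]] := fixdist_unbounded f N Xinf.
  by exists k => //; exists (FSymGrp xfin).
Qed.

(** * Lengths of finite cycles *)

Section Cycles.
Variable X : choiceType.
Implicit Types (p q : X) (f g h : symgrp X).

Definition exact_period (h : X -> X) p k : Prop :=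
  [/\ 0 < k, iter k h p = p & forall m, 0 < m < k -> iter m h p <> p].

Lemma exact_period_uniq (h : X -> X) p k l :
  exact_period h p k -> exact_period h p l -> k = l.
Proof.
move=> [k0 hk kmin] [l0 hl lmin]; have [lt|lt|//] := ltngtP k l.
  by case: (lmin k); rewrite ?k0.
by case: (kmin l); rewrite ?l0.
Qed.

Lemma exact_period_iter (h : X -> X) p k m : injective h ->
  exact_period h p k -> exact_period h (iter m h p) k.
Proof.
move=> h_inj [k0 hk kmin].
have it_inj : injective (iter m h) by elim: m => //= m IH x y /h_inj/IH.
split=> // [|r rk]; first by rewrite -iterD addnC iterD hk.
by rewrite -iterD addnC iterD => /it_inj; exact: kmin.
Qed.

Definition has_cycle (h : X -> X) k : Prop := exists p, exact_period h p k.

Lemma has_cycle_conj g h k : has_cycle h k -> has_cycle (g * h * g^-1) k.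
Proof.
move=> [p [k0 hk kmin]]; exists (g p).
have itE m : iter m (g * h * g^-1) (g p) = g (iter m h p).
  by elim: m => //= m ->; rewrite symgrpK.
split=> // [|m mk]; rewrite itE ?hk //.
by move=> /(can_inj (symgrpK g)); exact: kmin.
Qed.

(** For a list of [k] distinct points, [x] sends their images under [f] to the rotated list; then
    [x * f] runs through the points cyclically. *)
Lemma has_cycle_finitary f k : infinite_set [set: X] -> 0 < k ->
  exists2 x, finitary x & has_cycle (x * f) k.
Proof.
move=> Xinf; case: k => // k _; have f_inj := can_inj (symgrpK f).
have [[|a s] [us //= [ss] _]] := infinite_uniq k.+1 Xinf.
have [x xs xfix] := @finitary_extension X (map f (a :: s)) (rot 1 (a :: s))
  (etrans (map_inj_uniq f_inj _) us) (etrans (rot_uniq _ _) us)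
  (etrans (size_map _ _) (esym (size_rot _ _))).
exists x; first by apply/finitaryP; exists (map f (a :: s) ++ rot 1 (a :: s)) => p;
  rewrite mem_cat negb_or => /andP[]; exact: xfix.
have step m : m <= k -> (x * f) (nth a (a :: s) m) = nth a (rcons s a) m.
  move=> mk; rewrite symgrpME -rot1_cons -xs -map_comp.
  by rewrite (nth_map a) //= ss.
have it m : m <= k -> iter m (x * f) a = nth a (a :: s) m.
  elim: m => //= m IH mk; rewrite IH 1?ltnW // [LHS]step 1?ltnW //.
  by rewrite nth_rcons ss mk.
exists a; split=> // [|m /andP[m0 mk]].
  by rewrite iterS it // [LHS]step // nth_rcons ss ltnn eqxx.
have ltm : m < size (a :: s) by rewrite /= ss.
rewrite it // => E; have := nth_uniq a ltm (isT : 0 < size (a :: s)) us.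
by rewrite E eqxx => /esym/eqP m00; rewrite m00 in m0.
Qed.

End Cycles.

(** * Dynamics on rays and Houghton groups *)

Section Rays.
Variable n : nat.
Let X : choiceType := ('I_n * nat)%type.
Implicit Types (p q : X) (g h : symgrp X).

(** This is weaker than being eventually a translation: a permutation normalizing H_n is only seen
    to advance along a ray by some constant positive step. *)
Definition ray_monotone (h : X -> X) : Prop :=
  forall j, exists i S, forall s, S <= s ->
    (h (j, s)).1 = i /\ (h (j, s)).2 < (h (j, s.+1)).2.

Lemma finite_box S : finite_set [set p : X | p.2 < S]%classic.
Proof.
apply: sub_finite_set (finite_seq [seq (i, s) | i <- enum 'I_n, s <- iota 0 S]).
move=> [i s] /= lts; apply/allpairsP; exists (i, s) => /=.
by rewrite mem_enum mem_iota.
Qed.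

(* An orbit staying far out on the rays returns to a ray within n steps, and a
   monotone return map has no periodic point other than its fixed points.
   Hence the finite orbits of length > n meet a fixed finite box. *)
Lemma finite_cycle_lengths (h : X -> X) : injective h -> ray_monotone h ->
  finite_set (has_cycle h).
Proof.
move=> h_inj mono.
have [sigma sigmaP] := choice mono; have [Sj SjP] := choice sigmaP.
pose S := \max_j Sj j.
have ray j s : S <= s -> (h (j, s)).1 = sigma j.
  move=> Ss; have [] // := SjP j s; apply: leq_trans Ss.
  exact: (leq_bigmax j).
have incr j s : S <= s -> (h (j, s)).2 < (h (j, s.+1)).2.
  move=> Ss; have [] // := SjP j s; apply: leq_trans Ss.
  exact: (leq_bigmax j).
have lt_incr j u v : S <= u -> u < v -> (h (j, u)).2 < (h (j, v)).2.
  move=> Su /subnKC <-; elim: (v - u.+1) => [|d IH]; first by rewrite addn0 incr.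
  rewrite addnS; apply: ltn_trans IH _; apply: incr.
  by apply: (leq_trans Su); rewrite addSn -addnS leq_addr.
apply: (@sub_finite_set _ _ ([set k | k < n.+1] `|`
    \bigcup_(p in [set p : X | p.2 < S]) exact_period h p)%classic); last first.
  rewrite finite_setU; split; first exact: finite_II.
  apply: bigcup_finite => [|p _]; first exact: finite_box.
  have [[k pk]|nk] := pselect (exists k, exact_period h p k).
    by apply: sub_finite_set (finite_set1 k) => l pl; exact: exact_period_uniq pl pk.
  by apply: sub_finite_set (finite_set0 _) => k pk; apply: nk; exists k.
move=> k [p pk]; have [kn|nk] := ltnP k n.+1; [by left|right].
suff [m mS] : exists m, (iter m h p).2 < S.
  by exists (iter m h p) => //; exact: exact_period_iter.
apply: contrapT => nbox.
have far m : S <= (iter m h p).2.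
  by rewrite leqNgt; apply/negP => mS; apply: nbox; exists m.
have sync a b m : (iter a h p).1 = (iter b h p).1 ->
    (iter a h p).2 < (iter b h p).2 ->
    (iter (m + a) h p).1 = (iter (m + b) h p).1 /\
    (iter (m + a) h p).2 < (iter (m + b) h p).2.
  move=> ab1 ab2; elim: m => // m [].
  move: (far (m + a)) (far (m + b)); rewrite !addSn !iterS.
  case: (iter (m + a) h p) => j u; case: (iter (m + b) h p) => _ v /= Su Sv <- uv.
  by rewrite !ray //; split=> //; exact: lt_incr.
have /injectivePn[m1 [m2 m12 E]] :
    ~~ injectiveb (fun m : 'I_n.+1 => (iter m h p).1).
  by apply/negP => /injectiveP/leq_card; rewrite !card_ord ltnn.
wlog lt12 : m1 m2 m12 E / m1 < m2.
  move=> W; have [lt|lt|/val_inj eq12] := ltngtP m1 m2; first exact: (W m1 m2).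
    by apply: (W m2 m1); rewrite 1?eq_sym.
  by rewrite eq12 eqxx in m12.
have [_ hk kmin] := exact_period_iter m1 h_inj pk.
pose r := m2 - m1.
have m2E : r + m1 = m2 by rewrite subnK // ltnW.
have rk : 0 < r < k.
  by rewrite subn_gt0 lt12 /=; apply: leq_ltn_trans (leq_subr _ _) _;
     apply: leq_trans nk; exact: ltn_ord.
have hkr a : iter (a * k + m1) h p = iter m1 h p.
  by rewrite iterD; elim: a => //= a IH; rewrite mulSn iterD IH.
rewrite -m2E in E.
have hkr' : iter (k * r + m1) h p = iter m1 h p by rewrite mulnC hkr.
(* A rise over [r] steps repeats, so the height after [k * r] steps would be larger although the
   orbit is back at its start. A fall is excluded likewise, and equality contradicts the minimality
   of [k]. *)
have [lt|lt|eq2] := ltngtP (iter m1 h p).2 (iter (r + m1) h p).2.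
- suff W a : 0 < a -> (iter m1 h p).2 < (iter (a * r + m1) h p).2.
    by have := W k (leq_trans (ltn0Sn n) nk); rewrite hkr' ltnn.
  have st b : (iter (b * r + m1) h p).2 < (iter (b.+1 * r + m1) h p).2.
    by have [_] := sync _ _ (b * r)%N E lt; rewrite addnA -mulSnr.
  elim: a => // a IH _; apply: leq_ltn_trans (st a).
  by case: a IH => // a /(_ isT)/ltnW.
- suff W a : 0 < a -> (iter (a * r + m1) h p).2 < (iter m1 h p).2.
    by have := W k (leq_trans (ltn0Sn n) nk); rewrite hkr' ltnn.
  have st b : (iter (b.+1 * r + m1) h p).2 < (iter (b * r + m1) h p).2.
    by have [_] := sync _ _ (b * r)%N (esym E) lt; rewrite addnA -mulSnr.
  elim: a => // a IH _; apply: leq_trans (st a) _.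
  by case: a IH => // a /(_ isT)/ltnW.
- apply: (kmin r rk); rewrite -iterD.
  by case: (iter _ h p) (iter m1 h p) E eq2 => [j u] [j' u'] /= -> ->.
Qed.

(** The translation of the line formed by two rays, inwards on [i] and outwards on [j]. *)
Definition shift_fun (j i : 'I_n) (p : 'I_n * nat) : 'I_n * nat :=
  if p.1 == j then (j, p.2.+1)
  else if p.1 == i then if p.2 is s.+1 then (i, s) else (j, 0) else p.

Lemma shift_funK i j : i != j -> cancel (shift_fun j i) (shift_fun i j).
Proof.
move=> ij [l s]; have ji : j != i by rewrite eq_sym.
rewrite /shift_fun /=; have [->|lj] := eqVneq l j.
  by rewrite /= (negPf ji) eqxx.
have [->|li] := eqVneq l i; last by rewrite /= (negPf li) (negPf lj).
by case: s => [|s]; rewrite /= ?(negPf ji) ?eqxx.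
Qed.

Lemma shift_bij i j : i != j -> bijective (shift_fun j i).
Proof.
by move=> ij; exists (shift_fun i j); apply: shift_funK; rewrite // eq_sym.
Qed.

Lemma houghton_shift i j (ij : i != j) : houghton (symgrp_of (shift_bij ij)).
Proof.
apply/asboolP; exists (fun l => if l == j then 1 else if l == i then -1 else 0)%R.
move=> l; exists 1%N => s s1; rewrite /= /shift_fun /=.
have [->|_] := eqVneq l j; first by split=> //=; lia.
have [->|_] := eqVneq l i; last by split=> //=; lia.
by case: s s1 => // s _; split=> //=; lia.
Qed.

Lemma houghton_finitary (x : symgrp X) : finitary x -> houghton x.
Proof.
move=> /finitaryP[E xE]; apply/asboolP; exists (fun=> 0%R) => j.
exists (\max_(p <- E) p.2).+1 => s ltEs.
rewrite xE; first by split=> //=; lia.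
apply: contraL ltEs => jsE; rewrite -leqNgt.
exact: (@leq_bigmax_seq X _ predT (fun p => p.2) _ jsE isT).
Qed.

(** Conjugating the shift along ray [j] by [h] gives [g'] in H_n with h(j, s + 1) = g'(h(j, s)). As
    [g'] is eventually a translation on every ray, the image of ray [j] ends up in one ray and
    advances there by a constant. *)
Lemma normalizer_ray_monotone h : 1 < n ->
  (forall g : Houghton n, exists g' : Houghton n,
     h * houghton_val g * h^-1 = houghton_val g') ->
  ray_monotone h.
Proof.
move=> n1 hnorm j; have h_inj := can_inj (symgrpK h).
have [i ij] : exists i : 'I_n, i != j.
  have [->|j0] := eqVneq j (Ordinal (ltnW n1)); first by exists (Ordinal n1).
  by exists (Ordinal (ltnW n1)); rewrite eq_sym.
have [[g' g'P] /= hg] := hnorm (HoughtonElt (houghton_shift ij)).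
move/asboolP: (g'P) => [t /choice[Sl SlP]].
pose v s := h (j, s).
have vS s : v s.+1 = g' (v s).
  by rewrite -hg !symgrpME symgrpK /= /shift_fun /= eqxx.
pose S := \max_l Sl l.
(* Only finitely many points are sent by [h] into the box where [g'] need not be a translation. *)
have [N NP] : exists N, forall s, N <= s -> S <= (v s).2.
  have /finite_nat_ubound[N NP] :
      finite_set ((fun p => (h^-1 p).2) @` [set p : X | p.2 < S])%classic.
    exact/finite_image/finite_box.
  exists N => s Ns; rewrite leqNgt; apply/negP => vS'.
  have : s < N by apply: NP; exists (v s) => //; rewrite symgrpK.
  by rewrite ltnNge Ns.
have step s : N <= s -> (v s.+1).1 = (v s).1 /\
    ((v s.+1).2%:Z = (v s).2%:Z + t (v s).1)%R.
  move=> Ns; rewrite vS; have := NP s Ns; case: (v s) => l u /= Su.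
  by apply: SlP; apply: leq_trans Su; exact: (leq_bigmax l).
set i' := (v N).1.
have far m : (v (N + m)).1 = i' /\
    ((v (N + m)%N).2%:Z = (v N).2%:Z + m%:Z * t i')%R.
  elim: m => [|m [IH1 IH2]]; first by rewrite addn0; split=> //; lia.
  have [] := step (N + m) (leq_addr _ _); rewrite -addnS IH1 IH2 => -> ->.
  by split=> //; nia.
(* A zero step contradicts injectivity, and a negative one would make the height negative after
   [(v N).2.+1] steps. *)
have t0 : (0 < t i')%R.
  have [e1 e2] := far 1%N; have [_ e3] := far (v N).2.+1.
  have [t0|[t0|//]] : (t i' = 0 \/ t i' < 0 \/ 0 < t i')%R by lia.
    have : v (N + 1)%N = v N by apply: injective_projections => //; lia.
    by move=> /h_inj[]; lia.
  by nia.
exists i', N => s /subnKC <-.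
have [e1 e2] := far (s - N); have [_ e3] := far (s - N).+1.
rewrite -[h (j, N + _)]/(v _) -[h (j, (N + _).+1)]/(v _) -addnS.
split=> //; move: e2 e3 t0.
by set a := (v (N + _)).2; set b := (v (N + _)).2; set c := (v N).2; nia.
Qed.

End Rays.

Lemma houghton_R_infinity n : 1 < n -> R_infinity_property (Houghton n).
Proof.
move=> n1 phi; pose X : choiceType := ('I_n * nat)%type.
have Xinf : infinite_set [set: X].
  move=> fin; apply: infinite_nat.
  have <- : (snd @` [set: X] = [set: nat])%classic.
    apply/seteqP; split=> // s _; exists (Ordinal (ltnW n1), s) => //.
  exact: finite_image.
have valM : {morph @houghton_val n : x y / x * y} by [].
have val_swap (a b : X) : exists t : Houghton n, houghton_val t = swap a b.
  by exists (HoughtonElt (houghton_finitary (finitary_swap a b))).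
have [f fP] := aut_conj_by_permutation valM val_inj val_swap Xinf phi.
apply: (@infinite_twisted_classes _ phi
  (fun x k => has_cycle (houghton_val x * f) k)).
- move=> x y k [g ->] xk.
  rewrite !valM fP (morph_groupV valM) -!mulgA mulVg mulg1 !mulgA -(mulgA _ _ f).
  exact: has_cycle_conj.
- move=> x; apply: finite_cycle_lengths; first exact: (can_inj (symgrpK _)).
  (* [x * f] normalizes H_n because conjugation by [f] is [phi]. *)
  apply: normalizer_ray_monotone => // g; exists (x * phi g * x^-1).
  by rewrite !valM (morph_groupV valM) fP invgM !mulgA.
- move=> N; have [x xfin xk] := has_cycle_finitary f Xinf (ltn0Sn N).
  by exists N.+1 => //; exists (HoughtonElt (houghton_finitary xfin)).
Qed.

(** * The free group of rank 2 *)

Section FreeGroupRank2.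
Local Open Scope ring_scope.

Let V := (int * int)%type.
Implicit Types (a b : V) (u v z : freegrp bool).

Definition shear (c : int) (x : bool) a : V :=
  if x then (a.1, a.2 + c * a.1) else (a.1 + c * a.2, a.2).

Lemma shearK c x : cancel (shear c x) (shear (- c) x).
Proof. by case: x => -[a b]; rewrite /shear /=; congr (_, _); ring. Qed.

Lemma shearKV c x : cancel (shear (- c) x) (shear c x).
Proof. by case: x => -[a b]; rewrite /shear /=; congr (_, _); ring. Qed.

(** Sanov's pair of unipotent matrices with entry 3 instead of 2: the inverse shears must move the
    base vector (1, 1) strictly into a ping-pong region, and with 2 they would send it to the
    boundary. *)
Definition sanov (x : bool) : symgrp V :=
  symgrp_of (Bijective (shearK 3 x) (shearKV 3 x)).

Lemma sanovV x a : ((sanov x)^-1)%g a = shear (-3) x a.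
Proof. by rewrite -{1}[a](shearKV 3 x); exact: (symgrpK (sanov x)). Qed.

Definition sanov_rep : freegrp bool -> symgrp V := freelift sanov.

Lemma eval_word_cons (G : groupType) (h : bool -> G) l w :
  eval_word h (l :: w) = (eval_letter h l * eval_word h w)%g.
Proof. by rewrite /eval_word big_cons. Qed.

Definition pingpong_region (l : bool * bool) a : Prop :=
  match l, a with
  | (false, false), (p, q) => (0 < q < p) \/ (p < q < 0)
  | (false, true), (p, q) => (0 < q < - p) \/ (- p < q < 0)
  | (true, false), (p, q) => (0 < p < q) \/ (q < p < 0)
  | (true, true), (p, q) => (0 < p < - q) \/ (- q < p < 0)
  end.

(** Each letter maps every region except that of its inverse into its own region, and a reduced word
    never meets the exception. *)
Lemma sanov_pingpong l w : reduced (l :: w) ->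
  pingpong_region l (eval_word sanov (l :: w) (1, 1)).
Proof.
elim: w l => [|m w IH] l.
  rewrite eval_word_cons /eval_word big_nil mulg1 => _.
  by case: l => -[] [] /=; rewrite /eval_letter /= ?sanovV /shear /=; lia.
move=> /= /andP[lm rw]; move: {rw}(IH m rw).
rewrite (eval_word_cons _ l) [X in _ -> _ X]symgrpME.
case: (eval_word sanov (m :: w) (1, 1)) => p q.
by case: l lm => -[] []; case: m => -[] [] //= _;
  rewrite /eval_letter /= ?sanovV /shear /=; lia.
Qed.

(** Stronger than faithfulness: all four regions avoid the diagonal, so a nontrivial element moves
    (1, 1) off its own line. *)
Lemma sanov_base u : (sanov_rep u (1, 1)).1 = (sanov_rep u (1, 1)).2 -> u = 1%g.
Proof.
rewrite /sanov_rep /freelift; case: u => -[|l w] rw /=.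
  by move=> _; exact: val_inj.
move=> E; exfalso; move: E (sanov_pingpong rw).
case: (eval_word sanov (l :: w) (1, 1)) => p q.
by case: l {rw} => -[] [] /=; lia.
Qed.

Definition lincomb (c d : int) a b : V :=
  (c * a.1 + d * b.1, c * a.2 + d * b.2).

Lemma sanov_lincomb u c d a b :
  sanov_rep u (lincomb c d a b) = lincomb c d (sanov_rep u a) (sanov_rep u b).
Proof.
rewrite /sanov_rep /freelift; elim: (word u) => [|l w IH].
  by rewrite /eval_word big_nil.
rewrite eval_word_cons !symgrpME IH; move: (eval_word sanov w a) (eval_word sanov w b).
case: l => x [] [p q] [p' q']; rewrite /eval_letter /= ?sanovV;
  by case: x; rewrite /shear /lincomb /=; congr (_, _); ring.
Qed.

(* (1,1) is a cyclic vector for every z <> 1, so the commutation with z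
   determines u and v from u(1,1) and v(1,1). *)
Lemma free2_commute_trans z u v :
  commute z u -> commute z v -> z <> 1%g -> commute u v.
Proof.
move=> zu zv z1; pose e : V := (1, 1).
have sM : {morph sanov_rep : x y / (x * y)%g} by exact: freeliftM.
pose f x : V := sanov_rep x e.
have fM x y : f (x * y)%g = sanov_rep x (f y) by rewrite /f sM.
set t := f z; pose D := t.2 - t.1.
have D0 : D != 0.
  by rewrite subr_eq0; apply/eqP => E; apply: z1; apply: sanov_base; rewrite -E.
pose al (r : V) := t.2 * r.1 - t.1 * r.2; pose be (r : V) := r.2 - r.1.
(* Cramer's rule in the basis [e], [t] over the rationals, with denominator [D] cleared. *)
have dec r : lincomb D 0 r r = lincomb (al r) (be r) e t.
  by rewrite /lincomb /al /be /D /=; congr (_, _); ring.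
have act x r : lincomb D 0 (sanov_rep x r) (sanov_rep x r) =
    lincomb (al r) (be r) (f x) (sanov_rep x t).
  by rewrite -sanov_lincomb dec sanov_lincomb.
have com x : commute z x -> sanov_rep x t = sanov_rep z (f x).
  by move=> zx; rewrite -!fM zx.
(* The resulting formula for D^2 times x y (1, 1) is symmetric in [x] and [y]. *)
have key x y : commute z x -> commute z y ->
    (D * (D * (f (x * y)%g).1) = al (f x) * al (f y) +
       (al (f x) * be (f y) + be (f x) * al (f y)) * t.1 +
       be (f x) * be (f y) * (sanov_rep z t).1) *
    (D * (D * (f (x * y)%g).2) = al (f x) * al (f y) +
       (al (f x) * be (f y) + be (f x) * al (f y)) * t.2 +
       be (f x) * be (f y) * (sanov_rep z t).2).
  move=> zx zy; rewrite fM.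
  have := act x (f y); have := act z (f x); have := dec (f x).
  rewrite (com x zx) /lincomb !mul0r !addr0 => -[a1 a2] [b1 b2] [-> ->].
  have dist A B r m : D * (A * r + B * m) = A * (D * r) + B * (D * m) by ring.
  by split; rewrite dist ?a1 ?a2 ?b1 ?b2 -/t /=; ring.
have : f (u * v)%g = f (v * u)%g.
  have [[k1 k2] [k3 k4]] := (key u v zu zv, key v u zv zu).
  apply: injective_projections; apply: (mulfI D0); apply: (mulfI D0).
    by rewrite k1 k3; ring.
  by rewrite k2 k4; ring.
move=> fuv; apply: (mulgI (v * u)^-1)%g; rewrite mulVg.
by apply: sanov_base; rewrite -[sanov_rep _ _]/(f _) fM fuv -fM mulVg /f (morph_group1 sM).
Qed.

End FreeGroupRank2.

Lemma freegrp_ind (X : choiceType) (P : freegrp X -> Prop) :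
  P 1 -> (forall x u, P u -> P (freegen x * u)) ->
  (forall x u, P u -> P ((freegen x)^-1 * u)) -> forall u, P u.
Proof.
move=> P1 Pgen PgenV [w]; elim: w => [|l w IH] rlw.
  by rewrite (_ : FreeGrp _ = 1) //; exact: val_inj.
have := IH (reduced_cons rlw); case: l rlw => x [] rlw.
  move=> /(PgenV x); congr P; apply: val_inj => /=.
  by rewrite (cons_redE (l := (x, true))).
move=> /(Pgen x); congr P; apply: val_inj => /=.
by rewrite (cons_redE (l := (x, false))).
Qed.

(** * Exponent sums and the commutator subgroup *)

Section ExponentSum.
Local Open Scope ring_scope.
Variables (X : choiceType) (Z : zmodType) (h : X -> Z).

Definition expsum_letter (l : X * bool) : Z := if l.2 then - h l.1 else h l.1.

Definition expsum (u : freegrp X) : Z := \sum_(l <- word u) expsum_letter l.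

Lemma expsumM u v : expsum (u * v)%g = expsum u + expsum v.
Proof.
rewrite /expsum /=; elim: (word u) => [|l w IH] /=; first by rewrite big_nil add0r.
rewrite big_cons -addrA -{}IH; case: (mul_word w v) => [|m w'] /=.
  by rewrite !big_cons.
case: eqP => [->|_]; rewrite !big_cons // addrA; case: l => x [];
  by rewrite /expsum_letter /= ?addNr ?subrr add0r.
Qed.

Lemma expsum1 : expsum 1%g = 0. Proof. by rewrite /expsum big_nil. Qed.

Lemma expsumV u : expsum u^-1%g = - expsum u.
Proof. by apply/eqP; rewrite -addr_eq0 -expsumM mulVg expsum1. Qed.

Lemma expsum_gen x : expsum (freegen x) = h x.
Proof. by rewrite /expsum big_seq1. Qed.

End ExponentSum.

Section CommutatorSubgroup.
Implicit Types g u v w : freegrp bool.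

Definition ggcomm (G : groupType) (u v : G) : G := u * v * u^-1 * v^-1.

Definition free2_comm : freegrp bool := ggcomm (freegen false) (freegen true).

(** The normal closure of one commutator, which is the whole commutator subgroup by
    [comm_closure_commutator]. The inductive form serves to compute translations in
    [met_trans_endo]. *)
Inductive comm_closure : freegrp bool -> Prop :=
| CommClosure_comm : comm_closure free2_comm
| CommClosure_one : comm_closure 1
| CommClosure_mul u v : comm_closure u -> comm_closure v -> comm_closure (u * v)
| CommClosure_inv u : comm_closure u -> comm_closure u^-1
| CommClosure_conj w u : comm_closure u -> comm_closure (w * u * w^-1).

Lemma comm_closure_conjV w u : comm_closure u -> comm_closure (w^-1 * u * w).
Proof. by move/(CommClosure_conj w^-1); rewrite invgK. Qed.

(** With [u, v] for [ggcomm u v], the identity [x g, h] = x [g, h] x^-1 [x, h] and its analogue for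
    x^-1 reduce each argument to a generator. *)
Lemma comm_closure_commutator u v : comm_closure (ggcomm u v).
Proof.
have symm g h : comm_closure (ggcomm g h) -> comm_closure (ggcomm h g).
  by move/CommClosure_inv; rewrite /ggcomm !invgM !invgK !mulgA.
have gen x y : comm_closure (ggcomm (freegen x) (freegen y)).
  have comm1 g : ggcomm g g = 1 by rewrite /ggcomm mulgK mulgV.
  case: x y => -[]; rewrite ?comm1; try exact: CommClosure_one.
    exact/symm/CommClosure_comm.
  exact: CommClosure_comm.
have ext h : (forall x, comm_closure (ggcomm (freegen x) h)) ->
    forall g, comm_closure (ggcomm g h).
  move=> genh; apply: freegrp_ind => [|x g IH|x g IH].
  - by rewrite /ggcomm mul1g invg1 mulg1 mulgV; exact: CommClosure_one.
  - rewrite (_ : ggcomm _ _ = freegen x * ggcomm g h * (freegen x)^-1 *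
        ggcomm (freegen x) h).
      by apply: CommClosure_mul (genh x); exact: CommClosure_conj.
    by rewrite /ggcomm !invgM !mulgA !mulgVK.
  - rewrite (_ : ggcomm _ _ = (freegen x)^-1 * (ggcomm g h *
        (ggcomm (freegen x) h)^-1) * freegen x).
      apply: comm_closure_conjV; apply: CommClosure_mul => //.
      exact: CommClosure_inv.
    by rewrite /ggcomm !invgM !invgK !mulgA !mulgVK.
by apply: (ext) => x; apply: (symm); apply: (ext) => y; exact: gen.
Qed.

Definition zpowg (G : groupType) (g : G) (k : int) : G :=
  match k with Posz n => g ^+ n | Negz n => g ^- n.+1 end.

Lemma zpowg0 (G : groupType) (g : G) : zpowg g 0%R = 1. Proof. by []. Qed.

Lemma zpowgS (G : groupType) (g : G) k : g * zpowg g k = zpowg g (k + 1)%R.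
Proof.
case: k => [n|[|n]]; rewrite /zpowg.
- by rewrite -PoszD addn1 expgS.
- by rewrite expg1 mulgV.
- rewrite (_ : (Negz n.+1 + 1)%R = Negz n); last by rewrite !NegzE; lia.
  by rewrite [g ^+ n.+2]expgSr invgM mulVKg.
Qed.

Lemma zpowgVS (G : groupType) (g : G) k : g^-1 * zpowg g k = zpowg g (k - 1)%R.
Proof. by rewrite -[k in LHS](GRing.subrK 1%R) -zpowgS mulKg. Qed.

Definition expo (x : bool) : freegrp bool -> int :=
  expsum (fun y => (y == x)%:Z)%R.

(** Modulo commutators [u] equals [X u * Y u]; a new letter of the second kind is moved past [X u]
    at the cost of one commutator. *)
Lemma comm_closure_expo u : expo false u = 0%R -> expo true u = 0%R ->
  comm_closure u.
Proof.
pose X u := zpowg (freegen false) (expo false u).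
pose Y u := zpowg (freegen true) (expo true u).
suff nf : comm_closure (u * (X u * Y u)^-1).
  by move=> e0 e1; move: nf; rewrite /X /Y e0 e1 !zpowg0 mulg1 invg1 mulg1.
have eM x y v : expo x (freegen y * v) = (expo x v + (y == x)%:Z)%R.
  by rewrite /expo expsumM expsum_gen GRing.addrC.
have eV x y v : expo x ((freegen y)^-1 * v) = (expo x v - (y == x)%:Z)%R.
  by rewrite /expo expsumM expsumV expsum_gen GRing.addrC.
have stepY g v Z : comm_closure (v * (X v * Z)^-1) ->
    comm_closure (g * v * (X v * (g * Z))^-1).
  move=> IH; rewrite (_ : _ * _ = (g * (v * (X v * Z)^-1) * g^-1) * ggcomm g (X v)).
    by apply: CommClosure_mul (comm_closure_commutator _ _); exact: CommClosure_conj.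
  by rewrite /ggcomm !invgM !mulgA !mulgVK.
have stepX g v Z : comm_closure (v * Z^-1) -> comm_closure (g * v * (g * Z)^-1).
  by move=> /(CommClosure_conj g); rewrite invgM !mulgA.
elim/freegrp_ind: u => [|[] u IH|[] u IH].
- by rewrite /X /Y /expo !expsum1 !zpowg0 mulg1 invg1 mulg1; exact: CommClosure_one.
- by rewrite /X /Y !eM /= GRing.addr0 -zpowgS; exact: stepY.
- by rewrite /X /Y !eM /= GRing.addr0 -zpowgS -(mulgA _ (zpowg _ _)); exact: stepX.
- by rewrite /X /Y !eV /= GRing.subr0 -zpowgVS; exact: stepY.
- by rewrite /X /Y !eV /= GRing.subr0 -zpowgVS -(mulgA _ (zpowg _ _)); exact: stepX.
Qed.

End CommutatorSubgroup.

(** * Dual numbers, the pair (a, b) standing for a + b e with e^2 = 0 *)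

Definition dual (R : comNzRingType) : Type := (R * R)%type.

Section DualNumbers.
Local Open Scope ring_scope.
Variable R : comNzRingType.
Implicit Types x y z : dual R.

HB.instance Definition _ := GRing.Zmodule.copy (dual R) (R * R)%type.

Definition dual_one : dual R := (1, 0).
Definition dual_mul x y : dual R := (x.1 * y.1, x.1 * y.2 + x.2 * y.1).

Lemma dual_mulA : associative dual_mul.
Proof. by move=> x y z; rewrite /dual_mul /=; congr (_, _); ring. Qed.
Lemma dual_mulC : commutative dual_mul.
Proof. by move=> x y; rewrite /dual_mul /=; congr (_, _); ring. Qed.
Lemma dual_mul1 : left_id dual_one dual_mul.
Proof. by case=> a b; rewrite /dual_mul /=; congr (_, _); ring. Qed.
Lemma dual_mulDl : left_distributive dual_mul +%R.
Proof.
by move=> [a b] [c d] [e f]; rewrite /dual_mul /=; congr (_, _) => /=; ring.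
Qed.
Lemma dual_one_neq0 : dual_one != 0.
Proof. by apply/eqP => -[] /eqP; rewrite oner_eq0. Qed.

HB.instance Definition _ := GRing.Zmodule_isComNzRing.Build (dual R)
  dual_mulA dual_mulC dual_mul1 dual_mulDl dual_one_neq0.

End DualNumbers.

(** * An affine representation of the free group of rank 2 *)

Section MetabelianRepresentation.
Local Open Scope ring_scope.
Variables (A : comNzRingType) (s s' : bool -> A).
Hypothesis ss' : forall x, s x * s' x = 1.

Let V := (A * A)%type.
Implicit Types (v : V) (g h : freegrp bool).

(** A Magnus-type action, arranged so that the commutator of the generators translates the first
    coordinate by 1 and leaves the second one fixed. *)
Definition met_letter (x : bool) v : V :=
  if x then (s true * v.1 - v.2, v.2) else (s false * v.1, s false * v.2 + 1).

Definition met_letterV (x : bool) v : V :=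
  if x then (s' true * (v.1 + v.2), v.2)
  else (s' false * v.1, s' false * (v.2 - 1)).

Lemma met_letterK x : cancel (met_letter x) (met_letterV x).
Proof.
have s's y : s' y * s y = 1 by rewrite mulrC.
by case: x => -[P K]; rewrite /met_letter /met_letterV /= ?addrK ?addrNK ?subrK;
  rewrite !mulrA !s's !mul1r.
Qed.

Lemma met_letterVK x : cancel (met_letterV x) (met_letter x).
Proof.
by case: x => -[P K]; rewrite /met_letter /met_letterV /= !mulrA !ss' !mul1r
  ?addrK ?subrK.
Qed.

Definition met : freegrp bool -> symgrp V :=
  freelift (fun x => symgrp_of (Bijective (met_letterK x) (met_letterVK x))).

Lemma metM g h : met (g * h)%g = (met g * met h)%g. Proof. exact: freeliftM. Qed.

Lemma met_gen x v : met (freegen x) v = met_letter x v.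
Proof. by rewrite /met freelift_gen. Qed.

Lemma met_genV x v : met (freegen x)^-1%g v = met_letterV x v.
Proof.
rewrite (morph_groupV metM) -{1}[v](met_letterVK x) -met_gen.
exact: (symgrpK (met (freegen x))).
Qed.

Definition trans (f : A) v : V := (v.1 + f, v.2).

Lemma transD f f' v : trans f (trans f' v) = trans (f' + f) v.
Proof. by rewrite /trans /= addrA. Qed.

Definition met_trans g (f : A) : Prop := forall v, met g v = trans f v.

Lemma met_trans1 : met_trans 1%g 0.
Proof. by move=> [P K]; rewrite (morph_group1 metM) /trans addr0. Qed.

Lemma met_transM g h f f' :
  met_trans g f -> met_trans h f' -> met_trans (g * h)%g (f + f').
Proof. by move=> gf hf' v; rewrite metM symgrpME hf' gf transD addrC. Qed.

Lemma met_transV g f : met_trans g f -> met_trans g^-1%g (- f).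
Proof.
move=> gf v; rewrite (morph_groupV metM) -{1}[v](_ : met g (trans (- f) v) = _).
  exact: symgrpK.
by rewrite gf transD addNr /trans addr0; case: v.
Qed.

Lemma met_trans_uniq g f f' : met_trans g f -> met_trans g f' -> f = f'.
Proof.
by move=> gf gf'; have := gf (0, 0); rewrite gf' /trans !add0r => -[].
Qed.

Lemma met_trans_comm : met_trans free2_comm 1.
Proof.
move=> [P K]; rewrite /free2_comm /ggcomm !metM !symgrpME !met_gen !met_genV.
rewrite /met_letter /met_letterV /trans /=; congr (_, _).
  transitivity ((s false * s' false) * (s true * s' true) * (P + K) -
                (s false * s' false) * (K - 1)); first by ring.
  by rewrite !ss'; ring.
by rewrite mulrA ss' mul1r subrK.
Qed.

Variable chi : freegrp bool -> A.
Hypothesis chi1 : chi 1%g = 1.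
Hypothesis chiM : forall g h, chi (g * h)%g = chi g * chi h.
Hypothesis chi_gen : forall x, chi (freegen x) = s x.
Hypothesis chi_genV : forall x, chi (freegen x)^-1%g = s' x.

(** Each generator multiplies the first coordinate by its character value. Hence conjugation acts on
    translations through [chi], which is the module structure of F'/F''. *)
Lemma met_chi g f v : met g (trans f v) = trans (chi g * f) (met g v).
Proof.
elim/freegrp_ind: g f v => [|x g IH|x g IH] f v.
- by rewrite (morph_group1 metM) chi1 mul1r.
- rewrite metM !symgrpME IH !met_gen chiM chi_gen -mulrA; move: (chi g * f) => h.
  by rewrite /met_letter /trans; case: x => /=; congr (_, _); ring.
- rewrite metM !symgrpME IH !met_genV chiM chi_genV -mulrA; move: (chi g * f) => h.
  by rewrite /met_letterV /trans; case: x => /=; congr (_, _); ring.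
Qed.

Lemma met_trans_conj w g f : met_trans g f -> met_trans (w * g * w^-1)%g (chi w * f).
Proof.
move=> gf v; rewrite !metM !symgrpME gf met_chi (morph_groupV metM).
by rewrite symgrpVK.
Qed.

(* Psi maps the element of the commutator subgroup translating by f to one
   translating by u * sigma f: this is semilinearity of Psi on F'/F''. *)
Lemma met_trans_endo (Psi : freegrp bool -> freegrp bool) (sigma : A -> A) u :
    {morph Psi : g h / (g * h)%g} -> {morph sigma : a b / a + b} ->
    {morph sigma : a b / a * b} -> sigma 1 = 1 ->
    (forall g, chi (Psi g) = sigma (chi g)) -> met_trans (Psi free2_comm) u ->
  forall g, comm_closure g ->
    exists2 f, met_trans g f & met_trans (Psi g) (u * sigma f).
Proof.
move=> PsiM sD sM s1 chiPsi Psiu.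
have s0 : sigma 0 = 0 by apply: (addrI (sigma 0)); rewrite -sD !addr0.
have sN a : sigma (- a) = - sigma a.
  by apply/eqP; rewrite -addr_eq0 -sD addNr s0.
move=> g; elim=> [||v w _ [f vf pf] _ [f' wf' pf']|v _ [f vf pf]|w v _ [f vf pf]].
- by exists 1; [exact: met_trans_comm | rewrite s1 mulr1].
- exists 0; first exact: met_trans1.
  by rewrite (morph_group1 PsiM) s0 mulr0; exact: met_trans1.
- exists (f + f'); first exact: met_transM.
  by rewrite PsiM sD mulrDr; exact: met_transM.
- exists (- f); first exact: met_transV.
  by rewrite (morph_groupV PsiM) sN mulrN; exact: met_transV.
- exists (chi w * f); first exact: met_trans_conj.
  rewrite !PsiM (morph_groupV PsiM) sM mulrCA -chiPsi.
  exact: met_trans_conj.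
Qed.

Lemma comm_closure_met_trans g : comm_closure g -> exists f, met_trans g f.
Proof.
elim=> [||v w _ [f vf] _ [f' wf']|v _ [f vf]|w v _ [f vf]].
- by exists 1; exact: met_trans_comm.
- by exists 0; exact: met_trans1.
- by exists (f + f'); exact: met_transM.
- by exists (- f); exact: met_transV.
- by exists (chi w * f); exact: met_trans_conj.
Qed.

End MetabelianRepresentation.

Section HeisenbergCoefficient.
Local Open Scope ring_scope.
Variables (A B : comNzRingType) (s s' : bool -> A).
Variable ss' : forall x, s x * s' x = 1.
Variable eps : {rmorphism A -> B}.
Hypothesis eps_s : forall x, eps (s x) = 1.

Lemma met_heisenberg g : exists m, forall v : A * A,
  eps (met ss' g v).1 = eps v.1 - (expo true g)%:~R * eps v.2 + m /\
  eps (met ss' g v).2 = eps v.2 + (expo false g)%:~R.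
Proof.
have eps_s' x : eps (s' x) = 1 by rewrite -[LHS]mul1r -(eps_s x) -rmorphM ss' rmorph1.
have eM x y v : expo x (freegen y * v)%g = (y == x)%:Z + expo x v.
  by rewrite /expo expsumM expsum_gen.
have eV x y v : expo x ((freegen y)^-1 * v)%g = - (y == x)%:Z + expo x v.
  by rewrite /expo expsumM expsumV expsum_gen.
elim/freegrp_ind: g => [|x g [m IH]|x g [m IH]].
- exists 0 => v; rewrite (morph_group1 (metM ss')) /expo !expsum1.
  by rewrite mul0r subr0 !addr0.
- exists (if x then m - (expo false g)%:~R else m) => v.
  rewrite metM symgrpME met_gen !eM.
  have [h1 h2] := IH v; case: (met ss' g v) h1 h2 => P K /= h1 h2.
  rewrite /met_letter !intrD; case: x => /=;
    rewrite !(rmorphD, rmorphN, rmorphM, rmorph1) ?eps_s ?h1 ?h2 /=;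
    by split; ring.
- exists (if x then m + (expo false g)%:~R else m) => v.
  rewrite metM symgrpME met_genV !eV.
  have [h1 h2] := IH v; case: (met ss' g v) h1 h2 => P K /= h1 h2.
  rewrite /met_letterV !intrD; case: x => /=;
    rewrite !(rmorphD, rmorphN, rmorphM, rmorph1) ?eps_s' ?h1 ?h2 /=;
    by split; ring.
Qed.

(** A commutator in a Heisenberg group is central, given by the determinant of the abelianized
    coordinates. *)
Lemma met_trans_ggcomm g h u : met_trans ss' (ggcomm g h) u ->
  eps u = (expo false g * expo true h - expo true g * expo false h)%:~R.
Proof.
move=> uP; have [mg gP] := met_heisenberg g; have [mh hP] := met_heisenberg h.
have E : eps (met ss' (g * h)%g (0, 0)).1 = eps (met ss' (h * g)%g (0, 0)).1 + eps u.
  have -> : (g * h = ggcomm g h * (h * g))%g by rewrite /ggcomm !mulgA !mulgVK.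
  by rewrite metM symgrpME uP /trans /= rmorphD.
have [g1 g2] := (fun v => (gP v).1, fun v => (gP v).2).
have [h1 h2] := (fun v => (hP v).1, fun v => (hP v).2).
rewrite !metM !symgrpME !(g1, h1, g2, h2) !rmorph0 in E.
by rewrite rmorphB !rmorphM /=; move/esym/(canRL (addKr _)): E => ->; ring.
Qed.

End HeisenbergCoefficient.

(** * Twisted conjugacy for surjective endomorphisms of the free group of rank 2 *)

Section TwistedFree2.
Local Open Scope ring_scope.
Variable K : numClosedFieldType.

(** (c, l - a) is a left eigenvector unless it vanishes; in that case (l - d, b) serves if b is
    nonzero, and (1, 0) if not. *)
Lemma row_eigenvector (a b c d l : K) : (a - l) * (d - l) = b * c ->
  exists p : bool -> K, (exists x, p x != 0) /\
    p false * a + p true * c = l * p false /\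
    p false * b + p true * d = l * p true.
Proof.
move=> det0.
have mk (p0 p1 : K) : (p0 != 0) || (p1 != 0) -> p0 * a + p1 * c = l * p0 ->
    p0 * b + p1 * d = l * p1 ->
    exists p : bool -> K, (exists x, p x != 0) /\
    p false * a + p true * c = l * p false /\
    p false * b + p true * d = l * p true.
  move=> p01 e1 e2; exists (fun x => if x then p1 else p0); split=> //.
  by case/orP: p01; [exists false|exists true].
have [c0|c0] := eqVneq c 0; last first.
  apply: (mk c (l - a)); rewrite ?c0 //; first by ring.
  by rewrite mulrC -det0; ring.
have [al|al] := eqVneq a l; last first.
  apply: (mk c (l - a)); rewrite ?subr_eq0 1?[l == a]eq_sym ?al ?orbT //; first by ring.
  by rewrite mulrC -det0; ring.
have [b0|b0] := eqVneq b 0; last first.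
  by apply: (mk (l - d) b); rewrite ?b0 ?orbT // ?c0 ?al; ring.
by apply: (mk 1 0); rewrite ?oner_neq0 // ?c0 ?al ?b0; ring.
Qed.

Let A : comNzRingType := dual (dual K).

(** This is exp(a e + b d) = (1 + a e)(1 + b d), with e the inner and d the outer nilpotent. *)
Definition dualexp (a b : K) : A := ((1, a), (b, a * b)).

Lemma dualexpD a b a' b' : dualexp (a + a') (b + b') = dualexp a b * dualexp a' b'.
Proof.
by apply: injective_projections; apply: injective_projections => /=; ring.
Qed.

(** The ring endomorphism e -> l e, d -> m d. *)
Definition dualscale (l m : K) (x : A) : A :=
  ((x.1.1, l * x.1.2), (m * x.2.1, l * m * x.2.2)).

Lemma dualscaleD l m : {morph dualscale l m : x y / x + y}.
Proof.
move=> [[a b] [c d]] [[a' b'] [c' d']].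
by apply: injective_projections; apply: injective_projections => /=; ring.
Qed.

Lemma dualscaleM l m : {morph dualscale l m : x y / x * y}.
Proof.
move=> [[a b] [c d]] [[a' b'] [c' d']].
by apply: injective_projections; apply: injective_projections => /=; ring.
Qed.

Definition dual_re (R : comNzRingType) (x : dual R) : R := x.1.

Section DualRe.
Variable R : comNzRingType.
Lemma dual_re_is_zmod_morphism : zmod_morphism (@dual_re R).
Proof. by move=> x y. Qed.
Lemma dual_re_is_monoid_morphism : GRing.monoid_morphism (@dual_re R).
Proof. by split. Qed.
HB.instance Definition _ := GRing.isZmodMorphism.Build (dual R) R (@dual_re R)
  dual_re_is_zmod_morphism.
HB.instance Definition _ := GRing.isMonoidMorphism.Build (dual R) R (@dual_re R)
  dual_re_is_monoid_morphism.
End DualRe.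

Lemma additive_expo (Z : zmodType) (e : freegrp bool -> Z) :
  (forall g h, e (g * h)%g = e g + e h) ->
  forall g, e g = e (freegen false) *~ expo false g + e (freegen true) *~ expo true g.
Proof.
move=> eM; have e1 : e 1%g = 0 by apply: (addrI (e 1%g)); rewrite -eM mulg1 addr0.
have eV x : e (freegen x)^-1%g = - e (freegen x).
  by apply/eqP; rewrite -addr_eq0 -eM mulVg e1.
have zE (v : Z) : (v *~ Posz 0 = 0) * (v *~ Posz 1 = v) by [].
elim/freegrp_ind => [|x g IH|x g IH].
- by rewrite e1 /expo !expsum1 !mulr0z addr0.
- rewrite eM {1}IH /expo !expsumM !expsum_gen !mulrzDr.
  by case: x; rewrite /= !zE add0r; [exact: addrCA|exact: addrA].
- rewrite eM eV {1}IH /expo !expsumM !expsumV !expsum_gen !mulrzDr !mulrNz.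
  by case: x; rewrite /= !zE oppr0 add0r; [exact: addrCA|exact: addrA].
Qed.

Lemma comm_closure_expo0 x g : comm_closure g -> expo x g = 0.
Proof.
rewrite /expo; elim=> [||v w _ IHv _ IHw|v _ IH|w v _ IH].
- by rewrite /free2_comm /ggcomm !expsumM !expsumV; ring.
- exact: expsum1.
- by rewrite expsumM IHv IHw addr0.
- by rewrite expsumV IH oppr0.
- by rewrite !expsumM expsumV IH; ring.
Qed.

Section Endomorphism.
Variables (Psi : freegrp bool -> freegrp bool).
Hypothesis PsiM : {morph Psi : g h / (g * h)%g}.

Let m x y : int := expo x (Psi (freegen y)).

Lemma expo_endo x g :
  expo x (Psi g) = m x false * expo false g + m x true * expo true g.
Proof.
rewrite (@additive_expo _ (fun g => expo x (Psi g))) => [|u v].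
  by rewrite /m; congr (_ + _); exact: mulrzz.
by rewrite PsiM /expo expsumM.
Qed.

Lemma eigen_hom (l : K) :
  ((m false false)%:~R - l) * ((m true true)%:~R - l) =
    (m false true)%:~R * (m true false)%:~R ->
  exists p : freegrp bool -> K,
    [/\ forall g h, p (g * h)%g = p g + p h, exists x, p (freegen x) != 0 &
        forall g, p (Psi g) = l * p g].
Proof.
move=> /row_eigenvector[p [[x px] [p0 p1]]]; exists (expsum p).
have pM := @expsumM _ _ p; split=> //; first by exists x; rewrite expsum_gen.
move=> g; rewrite (@additive_expo _ (fun g => expsum p (Psi g))) => [|u v]; last first.
  by rewrite PsiM pM.
rewrite !(additive_expo pM (Psi _)) [in RHS](additive_expo pM g) !expsum_gen.
have zE x' (k : int) : p x' *~ k = p x' * k%:~R by rewrite mulrzr.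
by rewrite !zE mulrDr !mulrA -p0 -p1 /m; ring.
Qed.

(** Such a [p] is constant on twisted classes and separates the powers of a generator. *)
Lemma twisted_eigen1 (p : freegrp bool -> K) :
  (forall g h, p (g * h)%g = p g + p h) -> (exists x, p (freegen x) != 0) ->
  (forall g, p (Psi g) = p g) ->
  exists z : nat -> freegrp bool,
    forall a b g, z a = (g * z b * (Psi g)^-1)%g -> a = b.
Proof.
move=> pM [x px] pPsi; exists (fun n => (freegen x ^+ n)%g) => a b g.
have p1 : p 1%g = 0 by apply: (addrI (p 1%g)); rewrite -pM mulg1 addr0.
have pX n : p (freegen x ^+ n)%g = p (freegen x) *+ n.
  by elim: n => [|n IH]; rewrite ?expg0 // expgS pM IH mulrS.
move=> /(congr1 (fun u => p (u * Psi g)%g)).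
rewrite mulgVK !pM pPsi addrC => /addrI; rewrite !pX -!(mulr_natr (p _)).
by move=> /(mulfI px)/eqP; rewrite eqr_nat => /eqP.
Qed.

(** Preimages of the two generators provide an integral right inverse of the exponent matrix. *)
Lemma surjective_det : (forall y, exists x, Psi x = y) ->
  let d := m false false * m true true - m false true * m true false in
  d = 1 \/ d = -1.
Proof.
move=> Psi_surj d; have [g gE] := Psi_surj (freegen false).
have [h hE] := Psi_surj (freegen true).
have e x y : expo x (freegen y) = (y == x)%:Z by rewrite /expo expsum_gen.
have := expo_endo false g; have := expo_endo true g.
have := expo_endo false h; have := expo_endo true h.
rewrite gE hE !e /= => E1 E2 E3 E4.
have : d * (expo false g * expo true h - expo true g * expo false h) = 1.
  transitivity (1%:Z * 1%:Z - 0%:Z * 0%:Z); last by [].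
  by rewrite {1}E4 {1}E1 {1}E2 E3 /d; ring.
by move=> /(congr1 absz); rewrite abszM => /eqP; rewrite muln_eq1; lia.
Qed.


Theorem free2_infinite_twisted : (forall y, exists x, Psi x = y) ->
  exists z : nat -> freegrp bool,
    forall a b g, z a = (g * z b * (Psi g)^-1)%g -> a = b.
Proof.
move=> Psi_surj.
pose d := m false false * m true true - m false true * m true false.
have d1 : d = 1 \/ d = -1 := surjective_det Psi_surj.
pose tau : K := (m false false + m true true)%:~R.
pose r := sqrtC (tau ^+ 2 - 4 * d%:~R).
(* The roots of T^2 - tau T + d, the characteristic polynomial of the exponent matrix. *)
pose l := (tau + r) / 2; pose mu := (tau - r) / 2.
have n2 : (2 : K) != 0 by rewrite pnatr_eq0.
have lmuD : l + mu = tau by rewrite /l /mu; field.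
have lmuM : l * mu = d%:~R.
  transitivity ((tau ^+ 2 - r ^+ 2) / 4); first by rewrite /l /mu; field.
  by rewrite sqrtCK; field.
have root x y : x + y = tau -> x * y = d%:~R ->
    ((m false false)%:~R - x) * ((m true true)%:~R - x) =
    (m false true)%:~R * (m true false)%:~R.
  move=> xyD xyM; apply/eqP; rewrite -subr_eq0; apply/eqP.
  transitivity (d%:~R - x * (tau - x)).
    by rewrite /d /tau !(rmorphD, rmorphN, rmorphM) /=; ring.
  by rewrite -xyD -xyM; ring.
have [p [pM p0 pPsi]] := eigen_hom (root l mu lmuD lmuM).
have [q [qM q0 qPsi]] := eigen_hom (root mu l
  (etrans (addrC _ _) lmuD) (etrans (mulrC _ _) lmuM)).
have [l1|l1] := eqVneq l 1.
  by apply: (twisted_eigen1 pM p0) => g; rewrite pPsi l1 mul1r.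
have [mu1|mu1] := eqVneq mu 1.
  by apply: (twisted_eigen1 qM q0) => g; rewrite qPsi mu1 mul1r.
(* An equation between commutator elements forces g into the commutator
   subgroup, as 1 is not an eigenvalue on the abelianization. *)
have expo0 g : expo false (Psi g) = expo false g ->
    expo true (Psi g) = expo true g -> comm_closure g.
  rewrite !expo_endo => E1 E2.
  have det0 : (1 - m false false) * (1 - m true true) -
      m false true * m true false != 0.
    apply/eqP => /(congr1 (fun k : int => k%:~R : K)).
    rewrite rmorph0 => E; have : (1 - l) * (1 - mu) = 0.
      rewrite -[RHS]E; transitivity (1 - (l + mu) + l * mu); first by ring.
      by rewrite lmuD lmuM /tau /d !(rmorphD, rmorphN, rmorphM, rmorph1) /=; ring.
    by move/eqP; rewrite mulf_eq0 !subr_eq0 ![1 == _]eq_sym (negPf l1) (negPf mu1).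
  set i := expo false g in E1 E2 *; set j := expo true g in E1 E2 *.
  apply: comm_closure_expo; apply: (mulfI det0); rewrite mulr0 -/i -/j.
    transitivity ((1 - m true true) * (i - (m false false * i + m false true * j))
      + m false true * (j - (m true false * i + m true true * j))); first by ring.
    by rewrite E1 E2; ring.
  transitivity ((1 - m false false) * (j - (m true false * i + m true true * j))
    + m true false * (i - (m false false * i + m false true * j))); first by ring.
  by rewrite E1 E2; ring.
have add0 (e : freegrp bool -> K) : (forall g h, e (g * h)%g = e g + e h) -> e 1%g = 0.
  by move=> eM; apply: (addrI (e 1%g)); rewrite -eM mulg1 addr0.
have addV (e : freegrp bool -> K) g : (forall g h, e (g * h)%g = e g + e h) ->
    e g^-1%g = - e g.
  by move=> eM; apply/eqP; rewrite -addr_eq0 -eM mulVg add0.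
pose chi g := dualexp (p g) (q g).
have chiM g h : chi (g * h)%g = chi g * chi h by rewrite /chi pM qM dualexpD.
have chi1 : chi 1%g = 1.
  by rewrite /chi !add0 // /dualexp mulr0.
pose s x := chi (freegen x); pose s' x := chi (freegen x)^-1%g.
have ss' x : s x * s' x = 1 by rewrite /s /s' -chiM mulgV chi1.
have chiPsi g : chi (Psi g) = dualscale l mu (chi g).
  rewrite /chi pPsi qPsi /dualexp /dualscale /=.
  by congr (_, (_, _)); ring.
have scale1 : dualscale l mu 1 = 1.
  by apply: injective_projections; apply: injective_projections => /=; ring.
have PsiC : Psi free2_comm = ggcomm (Psi (freegen false)) (Psi (freegen true)).
  by rewrite /free2_comm /ggcomm !PsiM !(morph_groupV PsiM).
have sE x : chi (freegen x) = s x by [].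
have s'E x : chi (freegen x)^-1%g = s' x by [].
have [u uP] : exists u, met_trans ss' (Psi free2_comm) u.
  apply: (comm_closure_met_trans ss' chi1 chiM sE s'E).
  by rewrite PsiC; exact: comm_closure_commutator.
have u0 : u.1.1 = d%:~R.
  pose eps : {rmorphism A -> K} := @dual_re K \o @dual_re (dual K).
  have eps_s x : eps (s x) = 1 by [].
  rewrite PsiC in uP; have := met_trans_ggcomm eps_s uP.
  rewrite -[eps u]/(u.1.1) => ->.
  by congr (_ %:~R); rewrite /d /m; ring.
(* Here [g] lies in the commutator subgroup and translates by some [h]; then [Psi g] translates by u
   times the rescaled [h], and translations can be compared. *)
have twist z z' f f' g : comm_closure z -> comm_closure z' ->
    met_trans ss' z f -> met_trans ss' z' f' -> z' = (g * z * (Psi g)^-1)%g ->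
    exists h : A, f' = h + f - u * dualscale l mu h.
  move=> zC z'C zf z'f' E.
  have eg x : expo x (Psi g) = expo x g.
    have := congr1 (fun v => expo x (v * Psi g)%g) E.
    rewrite mulgVK [LHS]expsumM [RHS]expsumM -!/(expo x _).
    by rewrite (comm_closure_expo0 x zC) (comm_closure_expo0 x z'C) add0r addr0.
  have [h gh Psih] := met_trans_endo chi1 chiM sE s'E PsiM (@dualscaleD l mu)
    (@dualscaleM l mu) scale1 chiPsi uP (expo0 _ (eg false) (eg true)).
  exists h; apply: (met_trans_uniq z'f'); rewrite E.
  apply: met_transM; last exact: met_transV.
  exact: met_transM.
have trX g f n : met_trans ss' g f -> met_trans ss' (g ^+ n)%g (f *+ n).
  move=> gf; elim: n => [|n IH]; first by rewrite expg0; exact: met_trans1.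
  by rewrite expgS mulrS; exact: met_transM.
have ccX g n : comm_closure g -> comm_closure (g ^+ n)%g.
  move=> gC; elim: n => [|n IH]; first by rewrite expg0; exact: CommClosure_one.
  by rewrite expgS; exact: CommClosure_mul.
have dualMn (R : comNzRingType) (x : dual R) n : x *+ n = (x.1 *+ n, x.2 *+ n).
  by elim: n => [|n IH]; rewrite ?mulr0n // !mulrS IH.
have nat_inj (k : K) a b : k != 0 -> k *+ a = k *+ b -> a = b.
  by move=> k0; rewrite -!(mulr_natr k) => /(mulfI k0)/eqP; rewrite eqr_nat => /eqP.
(* For d = 1 the constant coefficients of h and of u times the rescaled h cancel, so those of f and
   f' agree; the n-th power of the commutator has constant coefficient n. *)
have [d1'|d1'] := d1.
  exists (fun n => free2_comm ^+ n)%g => a b g E.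
  have cC n : comm_closure (free2_comm ^+ n)%g by apply: ccX; exact: CommClosure_comm.
  have cf n := trX _ _ n (met_trans_comm ss').
  have [h] := twist _ _ _ _ _ (cC b) (cC a) (cf b) (cf a) E.
  move=> /(congr1 (fun x : A => x.1.1)); rewrite !dualMn /= u0 d1' mul1r.
  rewrite addrAC subrr add0r; exact/nat_inj/oner_neq0.
(* For d = -1 the element [w] below translates by (chi v - 1)(chi v' - 1), whose only term is k e d
   with this sum as k. *)
have [v [v' k0]] : exists v v', p (freegen v) * q (freegen v') +
    q (freegen v) * p (freegen v') != 0.
  case: p0 q0 => [x px] [y qy].
  have [qx|qx] := eqVneq (q (freegen x)) 0; last first.
    exists x, x; rewrite [q _ * _]mulrC -mulr2n -mulr_natr.
    by rewrite !mulf_neq0.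
  have [py|py] := eqVneq (p (freegen y)) 0; last first.
    exists y, y; rewrite [q _ * _]mulrC -mulr2n -mulr_natr.
    by rewrite !mulf_neq0.
  by exists x, y; rewrite py mulr0 addr0 mulf_neq0.
set k := _ + _ in k0.
pose conj_comm x w := (freegen x * w * (freegen x)^-1 * w^-1)%g : freegrp bool.
have ccc x w : comm_closure w -> comm_closure (conj_comm x w).
  by move=> wC; apply: CommClosure_mul; [exact: CommClosure_conj|exact: CommClosure_inv].
have trc x w f : met_trans ss' w f ->
    met_trans ss' (conj_comm x w) (chi (freegen x) * f - f).
  move=> wf; apply: met_transM; last exact: met_transV.
  exact: (met_trans_conj chi1 chiM sE s'E).
pose w := conj_comm v (conj_comm v' free2_comm).
have wC : comm_closure w by exact: (ccc _ _ (ccc _ _ CommClosure_comm)).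
have wf : met_trans ss' w ((0, 0), (0, k) : dual K).
  have := trc v _ _ (trc v' _ _ (met_trans_comm ss')); rewrite -/w.
  set f := (X in met_trans _ _ X); congr met_trans.
  by apply: injective_projections; apply: injective_projections => /=; rewrite /k; ring.
exists (fun n => w ^+ n)%g => a b g E.
have [[[h0 h1] [h2 h3]]] := twist _ _ _ _ _ (ccX _ b wC) (ccX _ a wC)
  (trX _ _ b wf) (trX _ _ a wf) E.
rewrite !dualMn /= => H.
have := congr1 (fun x : A => x.1.1) H; have := congr1 (fun x : A => x.1.2) H.
have := congr1 (fun x : A => x.2.1) H; have := congr1 (fun x : A => x.2.2) H.
rewrite /= {H} u0 d1' lmuM d1' => H4 H3 H2 H1.
(* The coefficients of h at 1, e and d vanish successively, being multiplied by 2, 1 + l and 1 + mu.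
   At e d the factor is d l mu = 1, so that coefficient of h cancels. *)
have lmuN1 : l * mu = -1 by rewrite lmuM d1'.
have l1' : 1 + l != 0.
  rewrite addrC addr_eq0; apply: contra mu1 => /eqP lN1.
  by move: lmuN1; rewrite lN1 mulN1r => /oppr_inj ->.
have mu1' : 1 + mu != 0.
  rewrite addrC addr_eq0; apply: contra l1 => /eqP muN1.
  by move: lmuN1; rewrite muN1 mulrN1 => /oppr_inj ->.
rewrite !mul0rn !addr0 rmorphN1 in H1 H2 H3 H4.
have h00 : h0 = 0.
  have : 2 * h0 = 0 by rewrite [RHS]H1; ring.
  by move/eqP; rewrite mulf_eq0 (negPf n2) => /eqP.
have h10 : h1 = 0.
  have : (1 + l) * h1 = 0 by rewrite [RHS]H2 h00; ring.
  by move/eqP; rewrite mulf_eq0 (negPf l1') => /eqP.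
have h20 : h2 = 0.
  have : (1 + mu) * h2 = 0 by rewrite [RHS]H3 h00; ring.
  by move/eqP; rewrite mulf_eq0 (negPf mu1') => /eqP.
by apply: (nat_inj k a b k0); rewrite H4 h00 h10 h20; ring.
Qed.

End Endomorphism.
End TwistedFree2.

(** * Pure symmetric automorphisms *)

Section GeneratedInduction.
Variables (G : groupType) (A : set G).

(** The elements which preserve [P] under left multiplication, together with their inverses, form a
    subgroup containing [A]. *)
Lemma gengrp_ind (P : gengrp A -> Prop) :
  P 1 -> (forall a g, A (genval a) -> P g -> P (a * g)) ->
  (forall a g, A (genval a) -> P g -> P (a^-1 * g)) -> forall g, P g.
Proof.
move=> P1 PM PVM.
pose S : {pred G} := fun x => `[< exists2 a : gengrp A, genval a = x &
  (forall g, P g -> P (a * g)) /\ (forall g, P g -> P (a^-1 * g)) >].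
have SG : group_closed S.
  split=> [|x y /asboolP[a <- [aP aVP]] /asboolP[b <- [bP bVP]]]; apply/asboolP.
    by exists 1 => //; rewrite invg1; split=> g; rewrite mul1g.
  exists (a / b) => //; split=> g gP; rewrite ?invgF -mulgA; first exact/aP/bVP.
  exact/bP/aVP.
have AS a : A a -> a \in S.
  move=> Aa; have gena : generated A a by apply/asboolP => S' _; apply.
  apply/asboolP; exists (GenGrp gena) => //.
  by split=> g; [exact: PM | exact: PVM].
case=> x gx; have /asboolP[a ax [aP _]] := asboolP _ gx S SG AS.
have -> : GenGrp gx = a * 1 by apply: val_inj; rewrite mulg1.
exact: aP.
Qed.

End GeneratedInduction.

(** * Generators and McCool's relations *)

Section PureSymmetric.
Variable n : nat.
Let F : groupType := freegrp 'I_n.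
Let G : groupType := pure_symmetric_aut n.
Let x (i : 'I_n) : F := freegen i.
Implicit Types (i j k l : 'I_n) (g h : G) (u v w : F).

Definition psact (g : G) : F -> F := autfun (genval g).

Lemma psact1 u : psact 1 u = u. Proof. by []. Qed.
Lemma psactM g h u : psact (g * h) u = psact g (psact h u). Proof. by []. Qed.
Lemma psact_morph g : {morph psact g : u v / u * v}. Proof. exact: autgrpM. Qed.
Lemma psactV g : {morph psact g : u / u^-1}.
Proof. exact/morph_groupV/psact_morph. Qed.
Lemma psactKV g u : psact g (psact g^-1 u) = u.
Proof. by rewrite -psactM mulgV. Qed.

Lemma psact_ext g h : (forall k, psact g (x k) = psact h (x k)) -> g = h.
Proof.
move=> gh; apply: val_inj; apply: val_inj; apply: symP.
by apply: freegrp_ext gh; exact: psact_morph.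
Qed.

(** Covering i = j, where [alpha i i] is the identity, lets [al] be a total function of its
    indices. *)
Lemma alpha_generated i j : generated (@pure_symmetric_gens n) (alpha i j).
Proof.
apply/asboolP => S [S1 _] gens; have [<-|ij] := eqVneq i j; last first.
  by apply: gens; exists i, j.
rewrite (_ : alpha i i = 1) //; apply: val_inj; apply: symP => /=.
apply: freegrp_ext => [u v|//|k]; first exact: alpha_funM.
by rewrite /alpha_fun freelift_gen; case: eqP => // ->; rewrite mulgK.
Qed.

Definition al i j : G := GenGrp (alpha_generated i j).

Lemma psact_al i j k :
  psact (al i j) (x k) = if k == i then x j * x i * (x j)^-1 else x k.
Proof. exact: alphaE. Qed.

Lemma pure_symmetric_ind (P : G -> Prop) :
  P 1 -> (forall i j g, i != j -> P g -> P (al i j * g)) ->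
  (forall i j g, i != j -> P g -> P ((al i j)^-1 * g)) -> forall g, P g.
Proof.
move=> P1 PM PVM; apply: gengrp_ind => // a g [i [j [ij aE]]] Pg.
  by rewrite (_ : a = al i j); [exact: PM | exact: val_inj].
by rewrite (_ : a = al i j); [exact: PVM | exact: val_inj].
Qed.

Lemma pure_symmetric_hom_ext (H : groupType) (f f' : G -> H) :
  {morph f : g h / g * h} -> {morph f' : g h / g * h} ->
  (forall i j, i != j -> f (al i j) = f' (al i j)) -> f =1 f'.
Proof.
move=> fM f'M E; elim/pure_symmetric_ind => [|i j g ij IH|i j g ij IH].
- by rewrite (morph_group1 fM) (morph_group1 f'M).
- by rewrite fM f'M IH E.
- by rewrite fM f'M (morph_groupV fM) (morph_groupV f'M) IH E.
Qed.

Lemma pure_symmetric_add_ext (f f' : G -> int) :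
  (forall g h, f (g * h)%g = f g + f h)%R ->
  (forall g h, f' (g * h)%g = f' g + f' h)%R ->
  (forall i j, i != j -> f (al i j) = f' (al i j)) -> f =1 f'.
Proof.
have f0 (e : G -> int) : (forall g h, e (g * h)%g = e g + e h)%R -> e 1 = 0%R.
  by move=> eM; apply: (addrI (e 1)); rewrite -eM mulg1 addr0.
have fV (e : G -> int) g : (forall g h, e (g * h)%g = e g + e h)%R -> e g^-1 = (- e g)%R.
  by move=> eM; apply/eqP; rewrite -addr_eq0 -eM mulVg f0.
move=> fM f'M E; elim/pure_symmetric_ind => [|i j g ij IH|i j g ij IH].
- by rewrite !f0.
- by rewrite fM f'M IH E.
- by rewrite fM f'M !fV // IH E.
Qed.

(** The case j = l is included: conjugations of different basis elements by the same one commute. *)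
Lemma al_commute_disjoint i j k l : i != k -> i != l -> j != k ->
  commute (al i j) (al k l).
Proof.
move=> ik il jk; apply: psact_ext => m.
have ki : k != i by rewrite eq_sym.
have li : l != i by rewrite eq_sym.
have E := (negPf ik, negPf il, negPf jk, negPf ki, negPf li, eqxx).
have [->|mk] := eqVneq m k.
  by do 4 rewrite ?psactM ?psact_al ?psact_morph ?psactV ?E.
have [->|mi] := eqVneq m i.
  by do 4 rewrite ?psactM ?psact_al ?psact_morph ?psactV ?E.
by do 4 rewrite ?psactM ?psact_al ?(negPf mi) ?(negPf mk).
Qed.

(** The product conjugates both x_i and x_k by x_j, which is compatible with conjugating x_i by
    x_k. *)
Lemma al_commute_prod i j k : i != j -> i != k -> j != k ->
  commute (al i j * al k j) (al i k).
Proof.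
move=> ij ik jk; apply: psact_ext => m.
have ji : j != i by rewrite eq_sym.
have ki : k != i by rewrite eq_sym.
have kj : k != j by rewrite eq_sym.
have E := (negPf ij, negPf ik, negPf jk, negPf ji, negPf ki, negPf kj, eqxx).
have [->|mi] := eqVneq m i.
  do 7 rewrite ?psactM ?psact_al ?psact_morph ?psactV ?E.
  by rewrite ?(invgM, invgK) ?mulgA ?mulgVK ?mulgK.
have [->|mk] := eqVneq m k.
  by do 4 rewrite ?psactM ?psact_al ?psact_morph ?psactV ?E.
by do 4 rewrite ?psactM ?psact_al ?(negPf mi) ?(negPf mk).
Qed.

End PureSymmetric.

(** * Solutions of McCool's relations in groups with transitive commutation *)

Section McCoolHomomorphisms.
Variables (n : nat) (H : groupType) (a : 'I_n -> 'I_n -> H).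
Implicit Types i j k l : 'I_n.
Hypothesis commute_trans : forall z u v : H,
  commute z u -> commute z v -> z <> 1 -> commute u v.
Hypothesis a_disjoint : forall i j k l,
  i != k -> i != l -> j != k -> commute (a i j) (a k l).
Hypothesis a_prod : forall i j k,
  i != j -> i != k -> j != k -> commute (a i j * a k j) (a i k).

Definition two_index_type i j : Prop :=
  forall x y, x != y -> (x, y) <> (i, j) -> (x, y) <> (j, i) -> a x y = 1.

(** The three product relations say that conjugation of F(x_i, x_j, x_k) by each of its basis
    elements is killed. *)
Definition three_index_type i j k : Prop :=
  [/\ [/\ i != j, i != k & j != k],
      [/\ a i j * a k j = 1, a i k * a j k = 1 & a j i * a k i = 1] &
      forall x y, x != y -> ~~ ((x \in [:: i; j; k]) && (y \in [:: i; j; k])) ->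
        a x y = 1].

Let triv (z u v : H) : ~ commute u v -> commute z u -> commute z v -> z = 1.
Proof. by move=> ncom zu zv; apply: contrapT => z1; apply/ncom/(commute_trans zu zv). Qed.

(** Every element claimed to be trivial commutes with two noncommuting values of [a]; for instance
    [a i j * a k j] commutes with both [a i j] and [a i k]. *)
Lemma three_index_of_fork i j k : i != j -> i != k -> j != k ->
  ~ commute (a i j) (a i k) -> three_index_type i j k.
Proof.
move=> ij ik jk ncom.
have [ji [ki kj]] : j != i /\ k != i /\ k != j by rewrite ![_ == i]eq_sym ![k == _]eq_sym.
have e1 : a i j * a k j = 1.
  apply: triv ncom _ (a_prod ij ik jk).
  apply: commute_sym; apply: commuteM; first exact: commute_refl.
  exact: a_disjoint.
have e2 : a i k * a j k = 1.
  apply: triv ncom (a_prod ik ij kj) _.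
  apply: commute_sym; apply: commuteM; first exact: commute_refl.
  exact: a_disjoint.
have ncom' : ~ commute (a j k) (a k j).
  rewrite -(mulg1_eq e1) -(mulg1_eq e2) => /commuteV/commute_sym/commuteV.
  by rewrite !invgK.
have e3 : a j i * a k i = 1.
  apply: triv ncom' (a_prod ji jk ik) _.
  rewrite (_ : a j i * a k i = a k i * a j i); first exact: a_prod.
  exact: a_disjoint.
split=> // x y xy; rewrite !inE negb_and !negb_or.
have [->|xi] := eqVneq x i.
  rewrite /= => /and3P[yi yj yk].
  by apply: triv ncom' _ _; apply: a_disjoint; rewrite // eq_sym.
have ail l : l != i -> l != j -> l != k -> a i l = 1.
  by move=> li lj lk; apply: triv ncom' _ _; apply: a_disjoint; rewrite // eq_sym.
have [->|xj] := eqVneq x j.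
  rewrite /= => /and3P[yi yj yk].
  apply: triv ncom _ _; last by apply: a_disjoint; rewrite // eq_sym.
  (* As [a i y] is trivial, [a j y] equals [a i y * a j y], which commutes with [a i j]. *)
  rewrite -[a j y]mul1g -(ail y) //; apply: a_prod; rewrite // eq_sym //.
have [->|xk] := eqVneq x k.
  rewrite /= => /and3P[yi yj yk].
  apply: triv ncom _ _; first by apply: a_disjoint; rewrite // eq_sym.
  rewrite -[a k y]mul1g -(ail y) //; apply: a_prod; rewrite // eq_sym //.
move=> _; have [yi|yi] := eqVneq y i.
  by apply: triv ncom' _ _; apply: a_disjoint; rewrite ?yi // eq_sym.
by apply: triv ncom _ _; apply: a_disjoint; rewrite // eq_sym.
Qed.

(** [a i k * a j k] commutes with [a i j] and [a j k], so [a j k] is inverse to [a i k] and the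
    chain becomes a fork. *)
Lemma three_index_of_chain i j k : i != j -> i != k -> j != k ->
  ~ commute (a i j) (a j k) -> three_index_type i j k.
Proof.
move=> ij ik jk ncom; have kj : k != j by rewrite eq_sym.
have ji : j != i by rewrite eq_sym.
have ki : k != i by rewrite eq_sym.
have e : a i k * a j k = 1.
  apply: triv ncom (a_prod ik ij kj) _.
  apply: commute_sym; apply: commuteM; last exact: commute_refl.
  exact: a_disjoint.
apply: three_index_of_fork => // com; apply: ncom.
by rewrite -(mulg1_eq e); exact: commuteV.
Qed.

Lemma three_index_of_noncommuting i j x y : i != j -> x != y ->
  (x, y) <> (j, i) -> ~ commute (a i j) (a x y) ->
  exists k l m, three_index_type k l m.
Proof.
move=> ij xy xyji ncom.
have [xi|xi] := eqVneq x i.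
  rewrite {}xi in xy xyji ncom *; have [yj|jy] := eqVneq j y.
    by case: ncom; rewrite yj; exact: commute_refl.
  by exists i, j, y; exact: three_index_of_fork.
have [xj|xj] := eqVneq x j.
  rewrite {}xj in xy xyji xi ncom *; have [yi|yi] := eqVneq i y.
    by case: xyji; rewrite yi.
  by exists i, j, y; exact: three_index_of_chain.
have [yi|yi] := eqVneq y i.
  rewrite {}yi in xy xyji ncom *; exists x, i, j.
  by apply: three_index_of_chain => // com; apply: ncom; exact: commute_sym.
by case: ncom; apply: a_disjoint; rewrite // eq_sym.
Qed.

(** Without a three-index triple only [a j i] can fail to commute with [a i j]; any other value
    commutes with both and is trivial. *)
Theorem noncommuting_type i j x y : i != j -> x != y ->
  ~ commute (a i j) (a x y) ->
  (exists k l, k != l /\ two_index_type k l) \/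
  (exists k l m, three_index_type k l m).
Proof.
move=> ij xy ncom.
have [three|nthree] := pselect (exists k l m, three_index_type k l m); first by right.
left; exists i, j; split=> // u v uv uvij uvji.
have noncom i' j' x' y' : i' != j' -> x' != y' ->
    ~ commute (a i' j') (a x' y') -> (x', y') = (j', i').
  move=> i'j' x'y' nc; apply: contrapT => ne; apply: nthree.
  exact: three_index_of_noncommuting nc.
have [xE yE] := noncom _ _ _ _ ij xy ncom; rewrite {x}xE {y}yE in xy ncom.
apply: triv ncom _ _; apply: commute_sym; apply: contrapT => nc.
  by apply: uvji; exact: noncom nc.
by apply: uvij; exact: noncom nc.
Qed.

End McCoolHomomorphisms.

(** * Homomorphisms from G_n to the free group of rank 2 *)

Section PairProjections.
Variable n : nat.
Let F : groupType := freegrp 'I_n.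
Let G : groupType := pure_symmetric_aut n.
Let F2 : groupType := freegrp bool.
Let x (i : 'I_n) : F := freegen i.
Let X (e : bool) : F2 := freegen e.
Implicit Types (i j k l a b c : 'I_n) (g h : G) (u v w : F).

Definition restr2 i j : F -> F2 :=
  freelift (fun k => if k == i then X false else if k == j then X true else 1).

Lemma restr2M i j : {morph restr2 i j : u v / u * v}.
Proof. exact: freeliftM. Qed.

Lemma restr2V i j : {morph restr2 i j : u / u^-1}.
Proof. exact/morph_groupV/restr2M. Qed.

Lemma restr2_gen i j k : restr2 i j (x k) =
  if k == i then X false else if k == j then X true else 1.
Proof. exact: freelift_gen. Qed.

Lemma free2_gens_noncommute : ~ commute (X false) (X true).
Proof. by move=> /(congr1 val). Qed.

Lemma free2_center (z : F2) : (forall e, commute z (X e)) -> z = 1.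
Proof.
move=> zX; apply: contrapT => z1; apply: free2_gens_noncommute.
exact: (free2_commute_trans (zX false) (zX true)).
Qed.

(* In F_2 = <x_i, x_j> the letters false, true stand for x_i, x_j. *)
Definition is_pair_conj i j g (t : F2) : Prop :=
  forall u, restr2 i j (psact g u) = t * restr2 i j u * t^-1.

Definition pair_conj_gen i j k l : F2 :=
  if (k == i) && (l == j) then X true
  else if (k == j) && (l == i) then X false else 1.

Lemma pair_conj_genP i j k l : i != j -> k != l ->
  is_pair_conj i j (al k l) (pair_conj_gen i j k l).
Proof.
move=> ij kl; apply: freegrp_ext => [u v|u v|m].
- by rewrite psact_morph restr2M.
- by rewrite restr2M !mulgA mulgVK.
have ji : j != i by rewrite eq_sym.
rewrite psact_al restr2_gen /pair_conj_gen.
have [->|mk] := eqVneq m k; last first.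
  rewrite restr2_gen; have [ki|ki] := eqVneq k i; have [kj|kj] := eqVneq k j.
  - by rewrite -ki -kj eqxx in ij.
  - rewrite ki in mk kl; rewrite /= (negPf mk); case: (eqVneq l j) => _.
      by case: (eqVneq m j) => _; rewrite ?mulgK ?mulg1 ?mulgV.
    by rewrite mul1g invg1 mulg1.
  - rewrite kj in mk kl; rewrite /= (negPf mk); case: (eqVneq l i) => _.
      by case: (eqVneq m i) => _; rewrite ?mulgK ?mulg1 ?mulgV.
    by rewrite mul1g invg1 mulg1.
  - by rewrite /= mul1g invg1 mulg1.
rewrite !restr2M restr2V !restr2_gen.
have [ki|ki] := eqVneq k i.
  rewrite ki (negPf ij) /=; have [li|li] := eqVneq l i; first by rewrite ki li eqxx in kl.
  by case: eqVneq => // _; rewrite if_same.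
have [kj|kj] := eqVneq k j.
  rewrite /=; have [//|li] := eqVneq l i.
  by have [lj|//] := eqVneq l j; rewrite kj lj eqxx in kl.
by rewrite /= !(mulg1, mul1g, invg1) mulgV.
Qed.

Lemma is_pair_conj1 i j : is_pair_conj i j 1 1.
Proof. by move=> u; rewrite psact1 mul1g invg1 mulg1. Qed.

Lemma is_pair_conjM i j g h t t' :
  is_pair_conj i j g t -> is_pair_conj i j h t' -> is_pair_conj i j (g * h) (t * t').
Proof. by move=> gt ht u; rewrite psactM gt ht invgM !mulgA. Qed.

Lemma is_pair_conjV i j g t : is_pair_conj i j g t -> is_pair_conj i j g^-1 t^-1.
Proof. by move=> gt u; rewrite -{2}(psactKV g u) gt invgK !mulgA mulVg mul1g mulgVK. Qed.

Lemma is_pair_conj_ex i j g : i != j -> exists t, is_pair_conj i j g t.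
Proof.
move=> ij; elim/pure_symmetric_ind: g => [|k l g kl [t gt]|k l g kl [t gt]].
- by exists 1; exact: is_pair_conj1.
- by exists (pair_conj_gen i j k l * t); apply: is_pair_conjM gt; exact: pair_conj_genP.
- exists ((pair_conj_gen i j k l)^-1 * t); apply: is_pair_conjM gt.
  exact/is_pair_conjV/pair_conj_genP.
Qed.

Lemma is_pair_conj_uniq i j g t t' : i != j ->
  is_pair_conj i j g t -> is_pair_conj i j g t' -> t = t'.
Proof.
move=> ij gt gt'; apply/esym/divg1_eq/invg_inj; rewrite invg1 invgF.
have ji : j != i by rewrite eq_sym.
suff com u : commute (t^-1 * t') (restr2 i j u).
  have E : t^-1 * t' = 1.
    apply: free2_center => -[].
      by have := com (x j); rewrite restr2_gen (negPf ji) eqxx.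
    by have := com (x i); rewrite restr2_gen eqxx.
  by rewrite -[t'](mulVKg t) E mulg1 mulgV.
have := gt u; rewrite gt' => E; rewrite /commute -mulgA.
apply: (mulgI t); rewrite mulVKg.
by apply: (mulIg t'^-1); rewrite E !mulgA mulgK.
Qed.

(** For i != j the conjugating element exists and is unique, as F_2 has trivial centre; the default
    1 can matter only for i = j. *)
Definition pair_proj i j g : F2 := xget 1 [set t | is_pair_conj i j g t]%classic.

Lemma pair_projP i j g : i != j -> is_pair_conj i j g (pair_proj i j g).
Proof. by move=> ij; have [t gt] := is_pair_conj_ex g ij; apply: (xgetPex 1); exists t. Qed.

Lemma pair_projE i j g t : i != j -> is_pair_conj i j g t -> pair_proj i j g = t.
Proof. by move=> ij; apply: is_pair_conj_uniq => //; exact: pair_projP. Qed.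

Lemma pair_projM i j : i != j -> {morph pair_proj i j : g h / g * h}.
Proof. by move=> ij g h; apply: pair_projE => //; apply: is_pair_conjM; exact: pair_projP. Qed.

Lemma pair_proj_al i j k l : i != j -> k != l ->
  pair_proj i j (al k l) = pair_conj_gen i j k l.
Proof. by move=> ij kl; apply: pair_projE => //; exact: pair_conj_genP. Qed.

(* F_n acts on F_2 x bool: x_b, x_c by translations of F_2, and x_a by switching
   the boolean over 1.  An element commuting with x_a preserves the fibre over 1,
   so it has trivial image in F_2. *)
Lemma conj_restr2_uniq a b c w w' : a != b -> a != c ->
  w * x a * w^-1 = w' * x a * w'^-1 -> restr2 b c w = restr2 b c w'.
Proof.
move=> ab ac E.
pose tr (t : F2) (p : F2 * bool) : F2 * bool := (t * p.1, p.2).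
have trK t : cancel (tr t) (tr t^-1) by case=> v e; rewrite /tr /= mulKg.
have trVK t : cancel (tr t^-1) (tr t) by case=> v e; rewrite /tr /= mulVKg.
pose sw (p : F2 * bool) : F2 * bool := if p.1 == 1 then (p.1, ~~ p.2) else p.
have swK : involutive sw.
  case=> v e; rewrite /sw /=; have [->|v1] := eqVneq v 1; first by rewrite eqxx negbK.
  by rewrite (negPf v1).
pose act : F -> symgrp (F2 * bool)%type := freelift (fun k =>
  if k == a then symgrp_of (inv_bij swK)
  else symgrp_of (Bijective (trK (restr2 b c (x k))) (trVK (restr2 b c (x k))))).
have actM : {morph act : u v / u * v} by exact: freeliftM.
have act_xa p : act (x a) p = sw p by rewrite /act freelift_gen eqxx.
have act_x k p : k != a -> act (x k) p = tr (restr2 b c (x k)) p.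
  by move=> ka; rewrite /act freelift_gen (negPf ka).
have pi_a : restr2 b c (x a) = 1 by rewrite restr2_gen (negPf ab) (negPf ac).
have act1_gen k p : (act (x k) p).1 = restr2 b c (x k) * p.1.
  have [->|ka] := eqVneq k a; last by rewrite act_x.
  by rewrite act_xa pi_a mul1g /sw; case: eqP.
have act1 u p : (act u p).1 = restr2 b c u * p.1.
  elim/freegrp_ind: u p => [|k u IH|k u IH] p.
  - by rewrite (morph_group1 actM) (morph_group1 (@restr2M b c)) mul1g.
  - by rewrite actM symgrpME act1_gen IH restr2M mulgA.
  - rewrite actM symgrpME restr2M restr2V -mulgA -IH (morph_groupV actM).
    by apply: (mulgI (restr2 b c (x k))); rewrite mulVKg -act1_gen symgrpVK.
have act2 u (v : F2) e : act u (v, ~~ e) = ((act u (v, e)).1, ~~ (act u (v, e)).2).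
  have gen k (p : F2 * bool) : act (x k) (p.1, ~~ p.2) = ((act (x k) p).1, ~~ (act (x k) p).2).
    have [->|ka] := eqVneq k a; last by rewrite !act_x.
    by rewrite !act_xa /sw /=; case: eqP.
  elim/freegrp_ind: u => [|k u IH|k u IH].
  - by rewrite (morph_group1 actM).
  - by rewrite actM !symgrpME IH gen.
  - rewrite actM !symgrpME IH (morph_groupV actM); set p := act u (v, e).
    by rewrite -{1 2}[p](symgrpVK (act (x k))) -gen symgrpK.
have pz : restr2 b c (w'^-1 * w) = 1.
  set z := w'^-1 * w.
  have com : act z (act (x a) (1, false)) = act (x a) (act z (1, false)).
    rewrite -!symgrpME -!actM; congr (act _ _).
    apply: (mulgI w'); rewrite /z -!mulgA mulVKg [RHS]mulgA.
    by apply: (mulIg w^-1); rewrite E !mulgA mulgK.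
  apply: contrapT => /eqP z1; move: com.
  rewrite act_xa /sw /= ?eqxx (act2 z 1 false) act_xa /sw act1 mulg1 (negPf z1).
  by case: (act z _) => v []; case.
by rewrite -[w](mulVKg w') restr2M pz mulg1.
Qed.

(** Composed with the inner automorphism by w^-1, [g] fixes x_a and induces conjugation by [t] on
    F(x_b, x_c). Inner automorphisms thus have image 1. *)
Definition is_triple_proj a b c g (t : F2) : Prop :=
  exists w s, [/\ psact g (x a) = w * x a * w^-1, is_pair_conj b c g s &
    t = (restr2 b c w)^-1 * s].

Lemma is_triple_proj_uniq a b c g t t' : a != b -> a != c -> b != c ->
  is_triple_proj a b c g t -> is_triple_proj a b c g t' -> t = t'.
Proof.
move=> ab ac bc [w [s [gw gs ->]]] [w' [s' [gw' gs' ->]]].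
rewrite (is_pair_conj_uniq bc gs gs'); congr (_^-1 * _).
by apply: (conj_restr2_uniq ab ac); rewrite -gw -gw'.
Qed.

Lemma is_triple_projM a b c g h t t' : is_triple_proj a b c g t ->
  is_triple_proj a b c h t' -> is_triple_proj a b c (g * h) (t * t').
Proof.
move=> [w [s [gw gs ->]]] [w' [s' [hw hs ->]]].
exists (psact g w' * w), (s * s'); split; last 1 first.
- by rewrite restr2M gs !invgM !invgK !mulgA mulgVK.
- by rewrite psactM hw !psact_morph psactV gw !invgM !mulgA.
- exact: is_pair_conjM.
Qed.

Lemma is_triple_projV a b c g t : is_triple_proj a b c g t ->
  is_triple_proj a b c g^-1 t^-1.
Proof.
move=> [w [s [gw gs ->]]]; exists (psact g^-1 w)^-1, s^-1.
have gsV := is_pair_conjV gs; split=> //.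
  rewrite invgK; have := congr1 (psact g^-1) gw.
  rewrite -psactM mulVg psact1 !psact_morph psactV => E; rewrite {2}E.
  by rewrite !mulgA mulVg mul1g mulgVK.
by rewrite restr2V gsV invgM !invgK mulgK.
Qed.

Definition triple_proj_gen a b c k l : F2 :=
  (if k == a then (restr2 b c (x l))^-1 else 1) * pair_conj_gen b c k l.

Lemma triple_proj_genP a b c k l : b != c -> k != l ->
  is_triple_proj a b c (al k l) (triple_proj_gen a b c k l).
Proof.
move=> bc kl; exists (if k == a then x l else 1), (pair_conj_gen b c k l).
split; [|exact: pair_conj_genP|].
  by rewrite psact_al [a == k]eq_sym; case: eqP => [->|] //; rewrite mul1g invg1 mulg1.
by rewrite /triple_proj_gen; case: eqP => // _; rewrite (morph_group1 (@restr2M b c)) invg1.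
Qed.

Lemma is_triple_proj_ex a b c g : b != c -> exists t, is_triple_proj a b c g t.
Proof.
move=> bc; elim/pure_symmetric_ind: g => [|k l g kl [t gt]|k l g kl [t gt]].
- exists 1, 1, 1; split; rewrite ?psact1 ?mul1g ?invg1 ?mulg1 //.
    exact: is_pair_conj1.
  by rewrite (morph_group1 (@restr2M b c)) invg1.
- exists (triple_proj_gen a b c k l * t); apply: is_triple_projM gt.
  exact: triple_proj_genP.
- exists ((triple_proj_gen a b c k l)^-1 * t); apply: is_triple_projM gt.
  exact/is_triple_projV/triple_proj_genP.
Qed.

Definition triple_proj a b c g : F2 :=
  xget 1 [set t | is_triple_proj a b c g t]%classic.

Lemma triple_projP a b c g : b != c ->
  is_triple_proj a b c g (triple_proj a b c g).
Proof.
by move=> bc; have [t gt] := is_triple_proj_ex a g bc; apply: (xgetPex 1); exists t.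
Qed.

Lemma triple_projM a b c : a != b -> a != c -> b != c ->
  {morph triple_proj a b c : g h / g * h}.
Proof.
move=> ab ac bc g h; apply: (is_triple_proj_uniq ab ac bc (triple_projP _ _ bc)).
by apply: is_triple_projM; exact: triple_projP.
Qed.

Lemma triple_proj_al a b c k l : a != b -> a != c -> b != c -> k != l ->
  triple_proj a b c (al k l) = triple_proj_gen a b c k l.
Proof.
move=> ab ac bc kl; apply: (is_triple_proj_uniq ab ac bc (triple_projP _ _ bc)).
exact: triple_proj_genP.
Qed.

End PairProjections.

(** The Heisenberg coefficient of the trivial commutator, over the integers with trivial
    character. *)
Lemma free2_commute_expo (u v : freegrp bool) : commute u v ->
  (expo false u * expo true v = expo true u * expo false v)%R.
Proof.
move=> uv; have one (b : bool) : (1 * 1 = 1 :> int)%R by [].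
have := @met_trans_ggcomm int int (fun=> 1%R) (fun=> 1%R) one idfun (fun=> erefl) u v 0%R.
rewrite (_ : ggcomm u v = 1); last by rewrite /ggcomm uv mulgK mulgV.
move=> /(_ (met_trans1 _)); rewrite /= intz => /esym/eqP.
by rewrite subr_eq0 => /eqP.
Qed.

(** The identity matrix of size 3 is no product of a 3 by 2 and a 2 by 3 matrix, because such a
    product has determinant 0. *)
Lemma no_rank2_identity (x1 x2 x3 y1 y2 y3 u1 u2 u3 v1 v2 v3 : int) :
  (x1 * u1 + y1 * v1 = 1)%R -> (x1 * u2 + y1 * v2 = 0)%R ->
  (x1 * u3 + y1 * v3 = 0)%R -> (x2 * u1 + y2 * v1 = 0)%R ->
  (x2 * u2 + y2 * v2 = 1)%R -> (x2 * u3 + y2 * v3 = 0)%R ->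
  (x3 * u1 + y3 * v1 = 0)%R -> (x3 * u2 + y3 * v2 = 0)%R ->
  (x3 * u3 + y3 * v3 = 1)%R -> False.
Proof.
move=> e11 e12 e13 e21 e22 e23 e31 e32 e33.
have : ((x1 * u1 + y1 * v1) *
   ((x2 * u2 + y2 * v2) * (x3 * u3 + y3 * v3) -
    (x2 * u3 + y2 * v3) * (x3 * u2 + y3 * v2)) -
  (x1 * u2 + y1 * v2) *
   ((x2 * u1 + y2 * v1) * (x3 * u3 + y3 * v3) -
    (x2 * u3 + y2 * v3) * (x3 * u1 + y3 * v1)) +
  (x1 * u3 + y1 * v3) *
   ((x2 * u1 + y2 * v1) * (x3 * u2 + y3 * v2) -
    (x2 * u2 + y2 * v2) * (x3 * u1 + y3 * v1)) = 0)%R by ring.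
by rewrite e11 e12 e13 e21 e22 e23 e31 e32 e33.
Qed.

Lemma finite_exact_period (T : finType) (f : T -> T) : T ->
  exists t m, exact_period f t m.
Proof.
move=> t0; have /injectivePn[m1 [m2 m12 E]] :
    ~~ injectiveb (fun m : 'I_#|T|.+1 => iter m f t0).
  by apply/negP => /injectiveP/leq_card; rewrite card_ord ltnn.
wlog lt12 : m1 m2 m12 E / m1 < m2.
  move=> W; have [lt|lt|/val_inj eq12] := ltngtP m1 m2; first exact: (W m1 m2).
    by apply: (W m2 m1); rewrite 1?eq_sym.
  by rewrite eq12 eqxx in m12.
have ex : exists k, (0 < k) && (iter k f (iter m1 f t0) == iter m1 f t0).
  exists (m2 - m1); rewrite subn_gt0 lt12 -iterD subnK; last exact: ltnW.
  exact/eqP/esym/E.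
case: (ex_minnP ex) => m /andP[m0 /eqP mE] mmin.
exists (iter m1 f t0), m; split=> // k /andP[k0 km] kE.
by have := mmin k; rewrite k0 kE eqxx leqNgt km => /(_ isT).
Qed.

(** * Isotropic classes and automorphisms of G_n *)

Section PureSymmetricAutomorphisms.
Variable n : nat.
Let G : groupType := pure_symmetric_aut n.
Let F2 : groupType := freegrp bool.
Implicit Types (i j k l a b c : 'I_n) (g h : G).

Definition additive (f : G -> int) : Prop := forall g h, (f (g * h)%g = f g + f h)%R.

(** The cup product of the two classes vanishes on every commuting pair, that is, on every map from
    a torus. *)
Definition wedge0 (f f' : G -> int) : Prop :=
  forall g h, commute g h -> (f g * f' h = f h * f' g)%R.

Lemma wedge0_sym f f' : wedge0 f f' -> wedge0 f' f.
Proof. by move=> w g h /commute_sym/w E; rewrite mulrC E mulrC. Qed.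

Lemma wedge0_oppr f f' : wedge0 f (fun g => - f' g)%R -> wedge0 f f'.
Proof. by move=> w g h /w; rewrite !mulrN => /oppr_inj. Qed.

Lemma wedge0_hom (r : G -> F2) : {morph r : g h / g * h} ->
  wedge0 (fun g => expo false (r g)) (fun g => expo true (r g)).
Proof.
move=> rM g h gh; rewrite free2_commute_expo 1?GRing.mulrC //.
by rewrite /commute -!rM gh.
Qed.

Definition pair_char i j (e : bool) g : int := expo e (pair_proj i j g).

Lemma pair_charM i j e : i != j -> additive (pair_char i j e).
Proof. by move=> ij g h; rewrite /pair_char pair_projM // /expo expsumM. Qed.

Lemma pair_char_al i j e k l : i != j -> k != l -> pair_char i j e (al k l) =
  Posz (nat_of_bool (if e then (k == i) && (l == j) else (k == j) && (l == i))).
Proof.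
move=> ij kl; rewrite /pair_char pair_proj_al // /pair_conj_gen.
have ex x y : expo x (freegen y) = ((y == x)%:Z)%R by rewrite /expo expsum_gen.
have [ki|ki] := eqVneq k i; have [kj|kj] := eqVneq k j.
- by rewrite -ki -kj eqxx in ij.
- by case: (l == j); case: e; rewrite /= ?ex // /expo expsum1.
- by case: (l == i); case: e; rewrite /= ?ex // /expo expsum1.
- by case: e; rewrite /= /expo expsum1.
Qed.

(* A class whose product with xi_ij and xi_ji vanishes on all commuting pairs is
   supported on alpha_ij and alpha_ji. *)
Lemma isotropic_support i j (f : G -> int) : i != j -> additive f ->
  (forall e, wedge0 f (pair_char i j e)) ->
  forall k l, k != l -> (k, l) <> (i, j) -> (k, l) <> (j, i) -> f (al k l) = 0%R.
Proof.
move=> ij fM f0 k l kl klij klji.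
have ji : j != i by rewrite eq_sym.
have f0T g h : commute g h -> (f g * pair_char i j true h =
  f h * pair_char i j true g)%R := f0 true g h.
have f0F g h : commute g h -> (f g * pair_char i j false h =
  f h * pair_char i j false g)%R := f0 false g h.
have charM := fun e => pair_charM e ij.
have [ki|ki] := eqVneq k i.
  rewrite ki in kl klij *; have lj : l != j by apply/eqP => E; apply: klij; rewrite E.
  have [jl li] : j != l /\ l != i by rewrite ![_ == l]eq_sym // [l == i]eq_sym.
  have := f0T _ _ (al_commute_prod ij kl jl).
  rewrite charM !pair_char_al ?eqxx ?(negPf lj) ?(negPf li) //= 1?eq_sym //.
  by rewrite mulr0 addr0 mulr1 => <-.
have [kj|kj] := eqVneq k j.
  rewrite kj in kl klji *; have li : l != i by apply/eqP => E; apply: klji; rewrite E.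
  have [il lj] : i != l /\ l != j by rewrite ![_ == l]eq_sym // [l == j]eq_sym.
  have := f0F _ _ (al_commute_prod ji kl il).
  rewrite charM !pair_char_al ?eqxx ?(negPf lj) ?(negPf li) //= 1?eq_sym //.
  by rewrite mulr0 addr0 mulr1 => <-.
have [li|li] := eqVneq l i.
  have := f0F _ _ (al_commute_disjoint (_ : k != j) (_ : k != i) (_ : l != j)).
  rewrite !pair_char_al ?eqxx ?(negPf kj) //= mulr0 mulr1 => -> //.
  by rewrite li.
have := f0T _ _ (al_commute_disjoint ki kj li).
by rewrite !pair_char_al ?eqxx ?(negPf ki) //= mulr0 mulr1.
Qed.

Lemma isotropic_span i j (f : G -> int) : i != j -> additive f ->
  (forall e, wedge0 f (pair_char i j e)) ->
  forall g, (f g = f (al i j) * pair_char i j true g +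
                  f (al j i) * pair_char i j false g)%R.
Proof.
move=> ij fM f0; have ji : j != i by rewrite eq_sym.
apply: pure_symmetric_add_ext => // [g h|k l kl].
  by rewrite !pair_charM //; ring.
rewrite !pair_char_al //.
have [[-> ->]|klij] := pselect ((k, l) = (i, j)).
  by rewrite !eqxx (negPf ij) /= mulr0 mulr1 addr0.
have [[-> ->]|klji] := pselect ((k, l) = (j, i)).
  by rewrite !eqxx (negPf ji) /= mulr0 mulr1 add0r.
have e1 : (k == i) && (l == j) = false.
  by apply/negP => /andP[/eqP ki /eqP lj]; apply: klij; rewrite ki lj.
have e2 : (k == j) && (l == i) = false.
  by apply/negP => /andP[/eqP kj /eqP li]; apply: klji; rewrite kj li.
by rewrite (isotropic_support ij fM f0 kl klij klji) e1 e2 !mulr0 addr0.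
Qed.

Definition triple_char a b c (e : bool) g : int := expo e (triple_proj a b c g).

Lemma triple_charM a b c e : a != b -> a != c -> b != c ->
  additive (triple_char a b c e).
Proof. by move=> ab ac bc g h; rewrite /triple_char triple_projM // /expo expsumM. Qed.

Lemma triple_char_al a b c e k l : a != b -> a != c -> b != c -> k != l ->
  triple_char a b c e (al k l) =
  (Posz (nat_of_bool ((k == if e then b else c) && (l == if e then c else b))) -
   Posz (nat_of_bool ((k == a) && (l == if e then c else b))))%R.
Proof.
move=> ab ac bc kl; have ba : b != a by rewrite eq_sym.
have ca : c != a by rewrite eq_sym.
have cb : c != b by rewrite eq_sym.
rewrite /triple_char triple_proj_al // /triple_proj_gen /pair_conj_gen.
have eM (u v : F2) : expo e (u * v) = (expo e u + expo e v)%R by exact: expsumM.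
have eV (u : F2) : expo e u^-1 = (- expo e u)%R by exact: expsumV.
have e1 d : expo d 1 = 0%R by exact: expsum1.
have ex d y : expo d (freegen y) = Posz (y == d) by rewrite /expo expsum_gen.
rewrite eM addrC; congr (_ + _)%R.
  have [->|kb] := eqVneq k b.
    rewrite (negPf bc) /=; case: e {eM eV} => /=; case: (eqVneq l c) => _;
      by rewrite ?e1 ?ex ?eqxx ?(negPf bc).
  have [->|kc] := eqVneq k c.
    rewrite /=; case: e {eM eV} => /=; case: (eqVneq l b) => _;
      by rewrite ?e1 ?ex ?eqxx ?(negPf cb).
  by rewrite e1; case: e {eM eV}; rewrite ?(negPf kb) ?(negPf kc).
case: eqP => [_|_] /=; last by rewrite e1 oppr0.
rewrite eV; congr (- _)%R; rewrite restr2_gen.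
have [->|lb] := eqVneq l b; first by rewrite ex; case: e {eM eV}; rewrite ?eqxx ?(negPf bc).
have [->|lc] := eqVneq l c; first by rewrite ex; case: e {eM eV}; rewrite ?eqxx ?(negPf cb).
by rewrite e1; case: e {eM eV}; rewrite ?(negPf lb) ?(negPf lc).
Qed.

Lemma additive_opp f : additive f -> additive (fun g => - f g)%R.
Proof. by move=> fM g h; rewrite fM opprD. Qed.

(* Up to sign, any two of the classes triple_char a b c false,
   triple_char a b c true and triple_char b a c false are the two coordinates of
   one homomorphism to F_2. *)
Lemma triple_char_rot a b c : a != b -> a != c -> b != c ->
  (forall g, triple_char b a c true g = - triple_char a b c true g)%R.
Proof.
move=> ab ac bc; have ba : b != a by rewrite eq_sym.
apply: pure_symmetric_add_ext => [||k l kl].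
- exact: triple_charM.
- exact/additive_opp/triple_charM.
- by rewrite !triple_char_al //= opprB.
Qed.

Lemma triple_char_rotF a b c : a != b -> a != c -> b != c ->
  (forall g, triple_char c a b false g = - triple_char b a c false g)%R.
Proof.
move=> ab ac bc; have ba : b != a by rewrite eq_sym.
have ca : c != a by rewrite eq_sym.
have cb : c != b by rewrite eq_sym.
apply: pure_symmetric_add_ext => [||k l kl].
- exact: triple_charM.
- exact/additive_opp/triple_charM.
- by rewrite !triple_char_al //= opprB.
Qed.

Lemma triple_char_rotTF a b c : a != b -> a != c -> b != c ->
  (forall g, triple_char c a b true g = - triple_char a b c false g)%R.
Proof.
move=> ab ac bc; have ba : b != a by rewrite eq_sym.
have ca : c != a by rewrite eq_sym.
have cb : c != b by rewrite eq_sym.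
apply: pure_symmetric_add_ext => [||k l kl].
- exact: triple_charM.
- exact/additive_opp/triple_charM.
- by rewrite !triple_char_al //= opprB.
Qed.

Section Automorphism.
Variable phi : autgrp G.

Let phiM : {morph phi : g h / g * h} := autgrpM phi.
Let phiK := symgrpK phi.
Let phiVK := symgrpVK phi.

Let phiVM : {morph (phi : symgrp G)^-1 : g h / g * h}.
Proof. by move=> g h; apply: (can_inj phiK); rewrite phiM !phiVK. Qed.

Let q i j k l : F2 := pair_proj i j (phi (al k l)).

Let qM i j : i != j -> {morph (fun g => pair_proj i j (phi g)) : g h / g * h}.
Proof. by move=> ij g h; rewrite phiM pair_projM. Qed.

Lemma no_three_index_type i j a b c : i != j -> ~ three_index_type (q i j) a b c.
Proof.
move=> ij [[ab ac bc] [r1 r2 r3] out].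
have ba : b != a by rewrite eq_sym.
have ca : c != a by rewrite eq_sym.
have cb : c != b by rewrite eq_sym.
pose U := triple_char a b c false; pose V := triple_char a b c true.
pose W := triple_char b a c false.
have [UM VM WM] : [/\ additive U, additive V & additive W].
  by split; exact: triple_charM.
have UV : wedge0 U V by apply: wedge0_hom; exact: triple_projM.
have WV : wedge0 W V.
  apply: wedge0_oppr; rewrite /V -(funext (triple_char_rot ab ac bc)).
  exact: wedge0_hom (triple_projM ba bc ac).
have WU : wedge0 W U.
  apply/wedge0_oppr/wedge0_sym/wedge0_oppr/wedge0_sym.
  rewrite /W -(funext (triple_char_rotF ab ac bc)).
  rewrite /U -(funext (triple_char_rotTF ab ac bc)).
  exact: wedge0_hom (triple_projM ca cb ab).
have wrefl f : wedge0 f f by move=> g h gh; rewrite mulrC.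
pose eta e g := pair_char i j e (phi g).
have etaM e : additive (eta e) by move=> g h; rewrite /eta phiM pair_charM.
(* The classes pulled back from pair_proj lie in the span of U, V, W. *)
have etaE e g : (eta e g = eta e (al c b) * U g + eta e (al b c) * V g +
                          eta e (al c a) * W g)%R.
  move: g; apply: pure_symmetric_add_ext => [|g h|k l kl]; first exact: etaM.
    by rewrite UM VM WM; ring.
  have etaE k' l' : eta e (al k' l') = expo e (q i j k' l') by [].
  have ex1 : expo e 1 = 0%R by exact: expsum1.
  have eN u v : u * v = 1 -> expo e u = (- expo e v)%R.
    move=> uv; have := expsumM (fun y => (y == e)%:Z)%R u v.
    rewrite uv -!/(expo e _) ex1 => /esym/eqP; rewrite addr_eq0 => /eqP //.
  rewrite /U /V /W !triple_char_al // !etaE /=.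
  have E := (negPf ab, negPf ac, negPf bc, negPf ba, negPf ca, negPf cb, eqxx).
  have [|nkl] := boolP ((k \in [:: a; b; c]) && (l \in [:: a; b; c])); last first.
    rewrite out // ex1; have F k' l' : k' \in [:: a; b; c] -> l' \in [:: a; b; c] ->
        (k == k') && (l == l') = false.
      by move=> k'in l'in; apply: contraNF nkl => /andP[/eqP-> /eqP->]; rewrite k'in.
    by rewrite !F ?inE ?eqxx ?orbT // !subrr !mulr0.
  rewrite !inE => /andP[/or3P[] /eqP kE /or3P[] /eqP lE]; rewrite kE lE ?eqxx // in kl *;
    rewrite !E /= ?(eN _ _ r1) ?(eN _ _ r2) ?(eN _ _ r3); ring.
have wedge_eta zeta e : wedge0 zeta U -> wedge0 zeta V -> wedge0 zeta W ->
    wedge0 zeta (eta e).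
  move=> zU zV zW g h gh; rewrite (etaE e g) (etaE e h).
  move: (zU g h gh) (zV g h gh) (zW g h gh) => e1 e2 e3.
  transitivity (eta e (al c b) * (zeta g * U h) + eta e (al b c) * (zeta g * V h) +
                eta e (al c a) * (zeta g * W h))%R; first by ring.
  by rewrite e1 e2 e3; ring.
(* Such a class is also orthogonal to both [eta e]; transported by the inverse of [phi] it is
   orthogonal to the coordinates of [pair_proj i j], so [isotropic_span] applies. *)
have span zeta : additive zeta -> wedge0 zeta U -> wedge0 zeta V -> wedge0 zeta W ->
    exists x y : int, forall g, (zeta g = x * eta true g + y * eta false g)%R.
  move=> zM zU zV zW; pose zeta' g := zeta ((phi : symgrp G)^-1 g).
  have z'M : additive zeta' by move=> g h; rewrite /zeta' phiVM zM.
  have z'0 e : wedge0 zeta' (pair_char i j e).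
    move=> g h gh; have := wedge_eta zeta e zU zV zW
      ((phi : symgrp G)^-1 g) ((phi : symgrp G)^-1 h).
    by rewrite /eta !phiVK; apply; rewrite /commute -!phiVM gh.
  have zE := isotropic_span ij z'M z'0.
  exists (zeta' (al i j)), (zeta' (al j i)) => g.
  by have := zE (phi g); rewrite {1}/zeta' phiK.
have [x1 [y1 zU]] := span U UM (wrefl U) UV (wedge0_sym WU).
have [x2 [y2 zV]] := span V VM (wedge0_sym UV) (wrefl V) (wedge0_sym WV).
have [x3 [y3 zW]] := span W WM WU WV (wrefl W).
have E := (negPf ab, negPf ac, negPf bc, negPf ba, negPf ca, negPf cb, eqxx).
(* The values of U, V, W at [al c b], [al b c], [al c a] form the identity matrix, yet all three lie
   in the span of two classes. *)
apply: (@no_rank2_identity x1 x2 x3 y1 y2 y3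
  (eta true (al c b)) (eta true (al b c)) (eta true (al c a))
  (eta false (al c b)) (eta false (al b c)) (eta false (al c a)));
  by rewrite -?zU -?zV -?zW /U /V /W triple_char_al // /= !E.
Qed.

Definition pair_lift i j : F2 -> G := freelift (fun e => if e then al i j else al j i).

Lemma pair_liftM i j : {morph pair_lift i j : u v / u * v}.
Proof. exact: freeliftM. Qed.

Lemma pair_proj_lift i j : i != j -> cancel (pair_lift i j) (pair_proj i j).
Proof.
move=> ij; have ji : j != i by rewrite eq_sym.
apply: freegrp_ext => [u v|//|e]; first by rewrite pair_liftM pair_projM.
rewrite /pair_lift freelift_gen; case: e; rewrite pair_proj_al // /pair_conj_gen.
  by rewrite !eqxx.
by rewrite (negPf ji) !eqxx.
Qed.

Lemma pair_proj_lift_other (i j k l : 'I_n) u : i < j -> k < l -> (i, j) != (k, l) ->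
  pair_proj k l (pair_lift i j u) = 1.
Proof.
move=> ij kl ne; have [ij' kl'] : i != j /\ k != l by rewrite !neq_ltn ij kl.
have ji' : j != i by rewrite eq_sym.
move: u; apply: (freegrp_ext (g := fun=> 1)) => [u v|u v|e].
- by rewrite pair_liftM pair_projM.
- by rewrite mulg1.
have nlk : (i == l) && (j == k) = false.
  by apply/negP => /andP[/eqP E1 /eqP E2]; rewrite E1 E2 in ij;
     have := ltn_trans ij kl; rewrite ltnn.
have nkl : (i == k) && (j == l) = false by rewrite -xpair_eqE (negPf ne).
rewrite /pair_lift freelift_gen; case: e; rewrite pair_proj_al // /pair_conj_gen.
  by rewrite nlk nkl.
by rewrite andbC nlk andbC nkl.
Qed.

(** [pair_proj i j] after [phi] is onto, since [phi] is bijective and [pair_lift i j] is a section;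
    commuting values on generators would make F_2 abelian. *)
Lemma q_noncommuting i j : i != j -> exists k l x y,
  [/\ k != l, x != y & ~ commute (q i j k l) (q i j x y)].
Proof.
move=> ij; apply: contrapT => nex; apply: free2_gens_noncommute.
have com k l x y : k != l -> x != y -> commute (q i j k l) (q i j x y).
  by move=> kl xy; apply: contrapT => nc; apply: nex; exists k, l, x, y.
pose p g := pair_proj i j (phi g).
have pM : {morph p : g h / g * h} := qM ij.
have pV := morph_groupV pM; have p1 := morph_group1 pM.
have ext v : (forall k l, k != l -> commute v (p (al k l))) -> forall g, commute v (p g).
  move=> vcom; elim/pure_symmetric_ind => [|k l g kl IH|k l g kl IH].
  - by rewrite p1; exact: commute1.
  - by rewrite pM; apply: commuteM IH; exact: vcom.
  - by rewrite pM pV; apply: commuteM IH; apply/commuteV/vcom.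
have all g h : commute (p g) (p h).
  apply: (ext) => k l kl; apply: commute_sym; apply: (ext) => x y xy; exact: com.
have surj u : u = p ((phi : symgrp G)^-1 (pair_lift i j u)).
  by rewrite /p phiVK pair_proj_lift.
by rewrite (surj (freegen false)) (surj (freegen true)).
Qed.

(** Only the two-index type is left: the composite kills all generators except [al k l] and
    [al l k], so it factors through [pair_proj k l]. *)
Lemma pair_proj_aut i j : i != j -> exists k l : 'I_n, k < l /\
  exists2 psi : F2 -> F2, {morph psi : u v / u * v} &
    forall g, pair_proj i j (phi g) = psi (pair_proj k l g).
Proof.
move=> ij; have [k0 [l0 [x0 [y0 [kl0 xy0 ncom]]]]] := q_noncommuting ij.
have qcom g h : commute g h ->
    commute (pair_proj i j (phi g)) (pair_proj i j (phi h)).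
  by move=> /(congr1 (fun g => pair_proj i j (phi g))); rewrite !phiM !pair_projM.
have := noncommuting_type (@free2_commute_trans) _ _ kl0 xy0 ncom.
case=> [k l x y kx ky lx|k l x kl kx lx||].
- exact/qcom/al_commute_disjoint.
- by rewrite /q -qM //; exact/qcom/al_commute_prod.
- move=> [k [l [kl two]]].
  wlog lt_kl : k l kl two / k < l.
    move=> W; have := kl; rewrite neq_ltn => /orP[lt|lt]; first exact: (W k l).
    apply: (W l k) => //; first by rewrite eq_sym.
    by move=> x y xy n1 n2; apply: two.
  exists k, l; split=> //.
  exists (freelift (fun e => if e then q i j k l else q i j l k)); first exact: freeliftM.
  apply: pure_symmetric_hom_ext => [|g h|x y xy]; first exact: qM.
    by rewrite pair_projM // freeliftM.
  rewrite pair_proj_al // /pair_conj_gen.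
  case: ifP => [/andP[/eqP-> /eqP->]|nkl]; first by rewrite freelift_gen.
  case: ifP => [/andP[/eqP-> /eqP->]|nlk]; first by rewrite freelift_gen.
  rewrite (morph_group1 (freeliftM _)); apply: two => //.
    by move=> [E1 E2]; rewrite E1 E2 !eqxx in nkl.
  by move=> [E1 E2]; rewrite E1 E2 !eqxx in nlk.
- by move=> [a [b [c]]] /no_three_index_type; case.
Qed.

Theorem pure_symmetric_infinite_twisted : 1 < n -> infinite_set (twisted_classes phi).
Proof.
move=> n1; pose T : finType := {p : 'I_n * 'I_n | p.1 < p.2}.
pose prj (t : T) := pair_proj (val t).1 (val t).2.
pose lft (t : T) := pair_lift (val t).1 (val t).2.
have neqT (t : T) : (val t).1 != (val t).2 by rewrite neq_ltn (valP t).
have /choice[next nextP] : forall t : T, exists t' : T,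
    exists2 psi : F2 -> F2, {morph psi : u v / u * v} &
      forall g, prj t (phi g) = psi (prj t' g).
  move=> t; have [k [l [kl psi]]] := pair_proj_aut (neqT t).
  by exists (Sub (k, l) kl).
have /choice[psi psiP] : forall t, exists psi : F2 -> F2,
    {morph psi : u v / u * v} /\ forall g, prj t (phi g) = psi (prj (next t) g).
  by move=> t; have [psi psiM psiE] := nextP t; exists psi.
have [t [m [m0 tm tmin]]] : exists t m, exact_period next t m.
  apply: finite_exact_period.
  by apply: (Sub (Ordinal (ltnW n1), Ordinal n1)).
(* A cycle t, next t, ..., next^m t = t of projections: the composite Psi of the
   psi's is induced by phi^m, and z |-> lft t z turns Psi-twisted classes into
   phi-twisted ones. *)
pose fix Psi (k : nat) : F2 -> F2 := if k is k'.+1 then Psi k' \o psi (iter k' next t) else id.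
have PsiM (k : nat) : {morph Psi k : u v / u * v}.
  by elim: k => //= k IH u v /=; rewrite (psiP _).1 IH.
have PsiE (k : nat) g : prj t (iter k phi g) = Psi k (prj (iter k next t) g).
  by elim: k g => //= k IH g; rewrite -iterS iterSr IH (psiP _).2.
have prjM s : {morph prj s : g h / g * h} by exact/pair_projM/neqT.
have prjK s : cancel (lft s) (prj s) by exact/pair_proj_lift/neqT.
have lft_other s s' u : s != s' -> prj s' (lft s u) = 1.
  move=> ss'; apply: pair_proj_lift_other; [exact: (valP s)|exact: (valP s')|].
  by rewrite -!surjective_pairing.
have Psi_surj y : exists x, Psi m x = y.
  have [g gE] : exists g, iter m phi g = lft t y.
    exists (iter m (phi : symgrp G)^-1 (lft t y)).
    move: (lft t y); elim: (m) => // k IH v.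
    by rewrite iterS [X in iter _ _ X]iterSr IH phiVK.
  by exists (prj t g); have := PsiE m g; rewrite tm gE prjK.
have [z zP] := free2_infinite_twisted algC (PsiM m) Psi_surj.
apply: (@infinite_twisted_classes _ phi
  (fun g (k : nat) => twisted_conj phi g (lft t (z k)))).
- by move=> g h k gh; apply: twisted_conj_trans; exact: twisted_conj_sym.
- move=> g; have [[k gk]|nk] := pselect (exists k : nat, twisted_conj phi g (lft t (z k))).
    apply: sub_finite_set (finite_set1 k) => l /= gl.
    have [w wE] := twisted_conj_trans (twisted_conj_sym gk) gl.
    apply: (zP _ _ (prj t w)).
    have wV : phi w^-1 = (phi w)^-1 := morph_groupV phiM w.
    have prjV s : {morph prj s : g / g^-1} := morph_groupV (prjM s).
    have prjw s : prj s (phi w) = psi s (prj (next s) w) := (psiP s).2 w.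
    have := congr1 (prj t) wE; rewrite !prjM !prjK wV prjV prjw => ->.
    congr (_ * _^-1).
    (* At the other projections s of the cycle both lifts vanish, so the twisted equation reads
       prj_s w = psi_s (prj_(next s) w), and the composite telescopes. *)
    have chain (j : nat) : 0 < j <= m -> Psi j (prj (iter j next t) w) = psi t (prj (next t) w).
      elim: j => // -[_ _|j IH /andP[_ jm]] //=.
      rewrite -[RHS]IH ?(ltnW jm) //=; congr (Psi _ (psi _ _)).
      have lift1 v : prj (iter j.+1 next t) (lft t v) = 1.
        by apply: lft_other; apply/eqP => /esym; apply: tmin; rewrite /= jm.
      have := congr1 (prj (iter j.+1 next t)) wE.
      rewrite !prjM !lift1 mulg1 wV prjV prjw => /esym/divg1_eq ->.
      by [].
    by rewrite -(chain m) ?tm // m0 leqnn.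
  by apply: sub_finite_set (finite_set0 _) => k gk; apply: nk; exists k.
- by move=> N; exists N => //; exists (lft t (z N)); exact: twisted_conj_refl.
Qed.

End Automorphism.
End PureSymmetricAutomorphisms.

Theorem theorem1p1 :
  [/\ R_infinity_property S_infinity,
      forall n : nat, 2 <= n -> R_infinity_property (Houghton n)
    & forall n : nat, 2 <= n -> R_infinity_property (pure_symmetric_aut n)].
Proof.
split; first exact/fsym_R_infinity/infinite_nat.
  exact: houghton_R_infinity.
by move=> n n1 phi; exact: pure_symmetric_infinite_twisted.
Qed.
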